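(* Let $d\ge1$ and $k\ge 1$ be fixed integers. Let $p$ be a prime, let $1\le U,V<p$ be integers, let ${\mathfrak C}\subseteq[1,U]\times[1,V]$ be a convex set, and let $\{\alpha_u\}_{u=1}^U$, $\{\beta_v\}_{v=1}^V$ be complex numbers with $|\alpha_u|,|\beta_v|\le 1$. For $(a,b)\in{\mathbb F}_p^*\times{\mathbb F}_p$ define $$S_{a,b,d}({\mathcal A},{\mathcal B};{\mathfrak C})=\sum_{(u,v)\in{\mathfrak C}}\alpha_u\beta_v\,{\mathbf e}_p\big(v/(au+b)^d\big),$$ where the sum is over integer points $(u,v)\in{\mathfrak C}$ with $au+b\not\equiv0\pmod p$. Then, uniformly over $(a,b)\in{\mathbb F}_p^*\times{\mathbb F}_p$ and over $U,V,{\mathfrak C}$ and the weights, as $p\to\infty$, $$|S_{a,b,d}({\mathcal A},{\mathcal B};{\mathfrak C})|\le V^{1-1/(2k)}\Big(U+U^{k/(k+1)}p^{1/(2k)}\Big)p^{o(1)}.$$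
   Context: ${\mathbf e}_p(z)=\exp(2\pi i z/p)$, where $v/(au+b)^d$ denotes an element of ${\mathbb F}_p$ represented by an integer in $\{0,\dots,p-1\}$. The notation $p^{o(1)}$ denotes a factor $p^{\epsilon(p)}$ with $\epsilon(p)\to0$ as $p\to\infty$, where $\epsilon$ may depend on $d,k$ only. *)

(* Defs.v *)
From HB Require Import structures.
From mathcomp Require Export all_boot all_order all_algebra.
From mathcomp Require Export complex.
From mathcomp Require Export all_classical all_reals all_analysis.

Set Implicit Arguments.
Unset Strict Implicit.
Unset Printing Implicit Defensive.

Import Order.TTheory GRing.Theory Num.Theory.
Import numFieldNormedType.Exports.

Local Open Scope ring_scope.
Local Open Scope complex_scope.
Local Open Scope classical_set_scope.

(* exp(2 pi i z / p), through Euler's formula. *)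
Definition e_p {R : realType} (p : nat) (z : R) : R[i] :=
  cos (2 * pi * z / p%:R) +i* sin (2 * pi * z / p%:R).

(* For p prime, [val] sends an element of 'F_p to its representative in
   {0, ..., p-1}. *)
Definition S_sum {R : realType} (p d U V : nat) (a b : 'F_p)
    (alpha beta : nat -> R[i]) (C : set (R^o * R^o)) : R[i] :=
  \sum_(1 <= u < U.+1) \sum_(1 <= v < V.+1 |
      (((u%:R, v%:R) : R^o * R^o) \in C) && (a * u%:R + b != 0))
    alpha u * beta v *
    e_p p (val (v%:R / (a * u%:R + b) ^+ d : 'F_p))%:R.

(* Main.v *)
(* Hoelder's inequality in v reduces the sum to the 2k-th moments, over all v in F_p, of sums over
   u in an interval depending on v; a dyadic decomposition of these intervals removes the dependence
   on v at the cost of powers of log p.  By orthogonality the moment is p times the number J of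
   solutions of an equation in 2k variables u_1, ..., u_2k <= U with summands +-(u_i + s)^-d.

   To bound J, write u + s = x (t + y) with x <= X prime, y <= Y = U / X and t = (u + s) / x - y.
   Every u has about X Y such representations, so J is controlled by the average over (x, t) of the
   number of solutions of the shifted equation in y_1, ..., y_2k <= Y with summands +-(t + y_i)^-d.
   The tuples in which every value is repeated contribute Y^k for each (x, t); any other tuple gives
   a nonzero polynomial in t, hence few values of t.  It remains to see that no t comes from many x.
   If it did, the pigeonhole principle would give t B = A with B <= X / m and |A| <= 2 U / m, and
   then B (u + s) = (A + B y) x, where the right-hand side is an integer smaller than p in absolute
   value: x divides one of few fixed nonzero integers less than p, and these x can be discarded.
   Taking X about min(U^((k-1)/(k+1)), p / U) gives the theorem. *)
Require Import Defs.
From mathcomp Require Import zify ring lra.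

Set Implicit Arguments.
Unset Strict Implicit.
Unset Printing Implicit Defensive.

Import Order.TTheory GRing.Theory Num.Theory.
Import numFieldNormedType.Exports.

Local Open Scope ring_scope.

(** * Central binomial coefficients and the number of primes up to X *)

Lemma logn_bin_double q n : prime q -> (0 < n)%N -> (q ^ logn q 'C(n.*2, n) <= n.*2)%N.
Proof.
move=> qP n0; set t := trunc_log q n.*2.
have q1 : (1 < q)%N := prime_gt1 qP.
have n20 : (0 < n.*2)%N by rewrite double_gt0.
suff le : (logn q 'C(n.*2, n) <= t)%N.
  apply: leq_trans (trunc_logP q1 n20); exact: leq_pexp2l (prime_gt0 qP) le.
have E : logn q (n.*2)`! = (logn q 'C(n.*2, n) + 2 * logn q n`!)%N.
  rewrite -(@bin_fact n.*2 n) -?addnn ?leq_addr // addKn.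
  rewrite !lognM ?muln_gt0 ?fact_gt0 ?bin_gt0 ?leq_addr //; lia.
rewrite !logn_fact // in E.
have E2 : (\sum_(1 <= k < n.+1) n %/ q ^ k = \sum_(1 <= k < n.*2.+1) n %/ q ^ k)%N.
  rewrite [RHS](big_cat_nat (n := n.+1)) /=; [|by []|by lia].
  rewrite [X in (_ + X)%N]big_nat_cond [X in (_ + X)%N]big1 ?addn0 // => i /andP[/andP[lo _] _].
  apply: divn_small; apply: leq_trans lo _; exact: ltnW (ltn_expl _ q1).
(* By Legendre's formula it remains to compare floors term by term: [n.*2 %/ q ^ k] exceeds twice
   [n %/ q ^ k] by at most 1, and both vanish for k > t. *)
suff B : (\sum_(1 <= k < n.*2.+1) n.*2 %/ q ^ k <= t + 2 * \sum_(1 <= k < n.*2.+1) n %/ q ^ k)%N.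
  by move: B; rewrite -E2 E leq_add2r.
have tb : (t <= n.*2)%N.
  by apply: leq_trans (trunc_logP q1 n20); exact: ltnW (ltn_expl _ q1).
have -> : t = (\sum_(1 <= k < n.*2.+1) (k <= t))%N.
  rewrite (big_cat_nat (n := t.+1)) //= [X in (_ + X)%N]big_nat_cond [X in (_ + X)%N]big1 => [|i].
    rewrite addn0 big_nat_cond (eq_bigr (fun=> 1%N)) => [|i /andP[/andP[_ h] _]].
      by rewrite -big_nat_cond sum_nat_const_nat muln1 subn1.
    by rewrite -ltnS h.
  by move=> /andP[/andP[h _] _]; rewrite leqNgt h.
rewrite big_distrr -big_split /=; rewrite big_nat_cond [leqRHS]big_nat_cond.
apply: leq_sum => i /andP[/andP[i1 _] _] /=.
have [it|ti] := leqP i t.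
  have Q0 : (0 < q ^ i)%N by rewrite expn_gt0 prime_gt0.
  have e := divn_eq n (q ^ i); rewrite -ltnS ltn_divLR // {1}e.
  by have := ltn_pmod n Q0; lia.
rewrite divn_small //; apply: leq_trans (trunc_log_ltn _ q1) _.
by rewrite leq_exp2l.
Qed.

(** Pascal's rule writes the next central coefficient as a sum of two equal entries of row 2n+1,
    each at least the current one. *)
Lemma expn2_le_bin_double n : (2 ^ n <= 'C(n.*2, n))%N.
Proof.
elim: n => // n IH; rewrite doubleS binS expnS mul2n -addnn.
have -> : 'C(n.*2.+1, n) = 'C(n.*2.+1, n.+1).
  by rewrite -bin_sub -addnn; [congr 'C(_, _); lia | lia].
have h : (2 ^ n <= 'C(n.*2.+1, n.+1))%N by rewrite (leq_trans IH) // binS leq_addl.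
exact: (leq_add h h).
Qed.

(* [1] is put in with the primes so that the count is positive even for [X = 1]. *)
Definition prime_or_one (x : nat) := (x == 1%N) || prime x.

(* Chebyshev: [2 ^ n <= 'C(2n, n)] is a product of at most [pi(2n)] prime powers, each [<= 2n]. *)
Lemma card_prime_or_one X L : (0 < L)%N -> (0 < X <= 2 ^ L)%N ->
  (X <= 3 * L * #|[pred x : 'I_X.+1 | prime_or_one x]|)%N.
Proof.
move=> L0 /andP[X0 XL]; set c := #|_|.
have c0 : (0 < c)%N.
  apply/card_gt0P; exists (inord 1); rewrite inE inordK //.
have [X3|X3] := leqP X 3; first by have := muln_gt0 L c; rewrite L0 c0; lia.
(* Since X > 3, X <= 2n + 1 <= 3n; this is the source of the factor 3. *)
pose n := X./2; have n0 : (0 < n)%N by rewrite /n; lia.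
have nX : (n.*2 <= X)%N by rewrite /n; lia.
suff : (n <= L * c)%N by rewrite /n; lia.
rewrite -(@leq_exp2l 2) //; apply: leq_trans (expn2_le_bin_double n) _.
have b0 : (0 < 'C(n.*2, n))%N by rewrite bin_gt0 -addnn leq_addr.
rewrite {1}(prod_prime_decomp b0) prime_decompE big_map /=.
apply: (@leq_trans (\prod_(q <- primes 'C(n.*2, n)) 2 ^ L)%N).
  rewrite big_seq [leqRHS]big_seq; apply: leq_prod => q.
  rewrite mem_primes => /andP[qP _].
  exact: leq_trans (logn_bin_double qP n0) (leq_trans nX XL).
rewrite big_const_seq iter_muln_1 -expnM leq_exp2l // leq_mul2l count_predT; apply/orP; right.
apply/card_geqP; exists (map (inord : nat -> 'I_X.+1) (primes 'C(n.*2, n))).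
have h q : q \in primes 'C(n.*2, n) -> prime q /\ (q < X.+1)%N.
  rewrite mem_primes => /and3P[qP _ qd]; split=> //; rewrite ltnS; apply: leq_trans nX.
  have : (0 < logn q 'C(n.*2, n))%N by rewrite logn_gt0 mem_primes qP b0.
  move=> l0; apply: leq_trans (logn_bin_double qP n0).
  by rewrite -{1}(expn1 q) leq_pexp2l // prime_gt0.
split; rewrite ?size_map //.
  rewrite map_inj_in_uniq ?primes_uniq // => q1 q2 /h[_ h1] /h[_ h2] /(congr1 val) /=.
  by rewrite !inordK.
by move=> x /mapP[q /h[qP qX] ->]; rewrite inE inordK // /prime_or_one qP orbT.
Qed.

(** r is at least the product of its distinct prime divisors, each of which is at least 2. *)
Lemma size_primes_lt r L : (0 < r < 2 ^ L)%N -> (size (primes r) < L)%N.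
Proof.
move=> /andP[r0 rL]; rewrite -(@ltn_exp2l 2) //; apply: leq_ltn_trans rL.
rewrite {2}(prod_prime_decomp r0) prime_decompE big_map /=.
rewrite -[size _]count_predT -iter_muln_1 -big_const_seq big_seq [leqRHS]big_seq.
apply: leq_prod => q qr; apply: (@leq_trans (q ^ 1)).
  by move: qr; rewrite mem_primes expn1 => /andP[/prime_gt1].
by rewrite leq_pexp2l ?logn_gt0 //; move: qr; rewrite mem_primes => /andP[/prime_gt0].
Qed.

(** Fewer than L primes divide r, which leaves room for the divisor 1. *)
Lemma card_prime_or_one_dvd X r L : (0 < r < 2 ^ L)%N ->
  (#|[pred x : 'I_X.+1 | prime_or_one x && (x %| r)]| <= L)%N.
Proof.
move=> rL; apply: leq_trans (size_primes_lt rL).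
have -> : (size (primes r)).+1 = size (1%N :: primes r) by [].
rewrite cardE -(size_map val); apply: uniq_leq_size.
  by rewrite map_inj_uniq ?enum_uniq //; exact: val_inj.
move=> x /mapP[y]; rewrite mem_enum inE /prime_or_one => /andP[h xr] ->.
rewrite inE; case/orP: h => [->//|h]; rewrite mem_primes h xr /=.
by case/andP: rL => -> _; rewrite orbT.
Qed.

(** * Counting solutions *)

(** The 2k variables are indexed by [bool * 'I_k], the boolean telling on which side of the equation
    a variable stands. *)
Definition signed (V : zmodType) (s : bool) (x : V) := if s then x else - x.

(* The number of [i_1, ..., i_2k] in [P] with [phi i_1 + ... + phi i_k = phi i_(k+1) + ... + phi i_2k]. *)
Definition zero_sums (V : zmodType) (k : nat) (I : finType) (P : pred I) (phi : I -> V) : nat :=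
  #|[pred f : {ffun bool * 'I_k -> I} |
     (f \in ffun_on P) && (\sum_j signed j.1 (phi (f j)) == 0)]|.

Lemma card_bool_ord k : #|{: bool * 'I_k}| = (2 * k)%N.
Proof. by rewrite card_prod card_bool card_ord. Qed.

Lemma signedM (F : pzRingType) s (x y : F) : signed s (x * y) = x * signed s y.
Proof. by case: s; rewrite /signed ?mulrN. Qed.

(** A tuple lying in a single fibre of [g] determines this fibre through its entry at [j0], so no
    solution is counted twice. For k = 0 the empty tuple would count once for every [q]. *)
Lemma zero_sums_sum_fibres (V : zmodType) k (I T : finType) (P : pred I) (phi : I -> V) (g : I -> T) :
  (0 < k)%N ->
  (\sum_q zero_sums k [pred i | P i && (g i == q)] phi <= zero_sums k P phi)%N.
Proof.
move=> k0; pose j0 : bool * 'I_k := (true, Ordinal k0).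
rewrite /zero_sums -sum1_card.
under eq_bigr do rewrite -sum1_card big_mkcond.
rewrite exchange_big [leqRHS]big_mkcond; apply: leq_sum => f _ /=.
rewrite (bigD1 (g (f j0))) //= big1 ?addn0 => [|q qn].
  case: ifP => // /andP[/ffun_onP h z]; rewrite ifT // inE z andbT.
  by apply/ffun_onP => j; have := h j; rewrite !inE => /andP[].
case: ifP => // /andP[/ffun_onP/(_ j0)]; rewrite !inE => /andP[_ /eqP e].
by rewrite e eqxx in qn.
Qed.

(* Each solution in [P] lifts along [r] to at least [n ^ (2 * k)] solutions in [P']. *)
Lemma zero_sums_lift (F : idomainType) k (I I' : finType) (P : pred I) (P' : pred I')
    (phi : I -> F) (phi' : I' -> F) (r : I -> pred I') (lam : F) n :
  (forall i i', P i -> r i i' -> P' i' /\ phi' i' = lam * phi i) ->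
  (forall i1 i2 i', P i1 -> P i2 -> r i1 i' -> r i2 i' -> i1 = i2) ->
  (forall i, P i -> (n <= #|r i|)%N) ->
  (n ^ (2 * k) * zero_sums k P phi <= zero_sums k P' phi')%N.
Proof.
move=> rP rI rn; rewrite /zero_sums -!sum1_card big_distrr /=.
pose fam (f : {ffun bool * 'I_k -> I}) := family (fun j => r (f j)).
apply: (@leq_trans (\sum_(f : {ffun bool * 'I_k -> I} | (f \in ffun_on P) &&
     (\sum_j signed j.1 (phi (f j)) == 0)%R) #|fam f|)%N).
  apply: leq_sum => f; rewrite inE => /andP[/ffun_onP fP _].
  rewrite muln1 card_family foldrE big_image /= -card_bool_ord -prod_nat_const.
  by apply: leq_prod => j _; exact/rn/fP.
rewrite (eq_bigr (fun f => \sum_(f' : {ffun bool * 'I_k -> I'}) (if f' \in fam f then 1 else 0))%N);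
  last by move=> f _; rewrite -sum1_card big_mkcond.
rewrite exchange_big [leqRHS]big_mkcond /=; apply: leq_sum => f' _.
(* The entries of [f'] determine those of [f], so [f'] belongs to the family of at most one
   solution. *)
case: (pickP [pred f : {ffun bool * 'I_k -> I} | [&& f \in ffun_on P,
     \sum_j signed j.1 (phi (f j)) == 0 & f' \in fam f]]) => [f0 /and3P[f0P f00 f0f']|none]; last first.
  rewrite big1 // => f /andP[f1 f2]; case: ifP => // f3.
  by have := none f; rewrite /= f1 f2 f3.
have P0 j : P (f0 j) by move/ffun_onP: f0P => /(_ j).
have r0 j : r (f0 j) (f' j) by move/familyP: f0f' => /(_ j).
rewrite (bigD1 f0) /= ?f0P //= f0f' big1 => [|f /andP[/andP[/ffun_onP f1 f2] fn]]; last first.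
  case: ifP => // /familyP f3; case/eqP: fn; apply/ffunP => j.
  exact: (rI _ _ _ (f1 j) (P0 j) (f3 j) (r0 j)).
rewrite ifT // inE; apply/andP; split.
  by apply/ffun_onP => j; case: (rP _ _ (P0 j) (r0 j)).
rewrite (eq_bigr (fun j => lam * signed j.1 (phi (f0 j)))) => [|j _].
  by rewrite -mulr_sumr (eqP f00) mulr0.
by case: (rP _ _ (P0 j) (r0 j)) => _ ->; rewrite signedM.
Qed.

Lemma zero_sums_scale (F : idomainType) k (I : finType) (P : pred I) (phi : I -> F) (c : F) :
  c != 0 -> zero_sums k P (fun i => c * phi i) = zero_sums k P phi.
Proof.
move=> c0; apply: eq_card => f; rewrite !inE; congr (_ && _).
by under eq_bigr do rewrite signedM; rewrite -mulr_sumr mulf_eq0 (negPf c0).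
Qed.

(** * Moments of exponential sums *)

(** Hölder's inequality for an integer exponent, proved algebraically over any [numDomainType]
    because it is applied to norms with values in a [numClosedFieldType]. *)
Lemma power_mean (D : numDomainType) (I : finType) (P : pred I) (a : I -> D) n :
  (forall i, P i -> 0 <= a i) ->
  (\sum_(i | P i) a i) ^+ n.+1 <= #|P|%:R ^+ n * \sum_(i | P i) a i ^+ n.+1.
Proof.
move=> a0; elim: n => [|n IH]; first by rewrite !expr1 mul1r.
have s0 : 0 <= \sum_(i | P i) a i by exact: sumr_ge0.
rewrite exprS; apply: le_trans (ler_wpM2l s0 IH) _.
rewrite mulrCA exprSr -mulrA; apply: ler_wpM2l; first by rewrite exprn_ge0.
rewrite -subr_ge0 -(pmulr_rge0 _ (ltr0Sn D 1)).
(* Chebyshev's sum inequality: both sequences [a] and [a ^+ n.+1] are ordered alike. *)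
have -> : 2%:R * (#|P|%:R * (\sum_(i | P i) a i ^+ n.+2) -
    (\sum_(i | P i) a i) * (\sum_(i | P i) a i ^+ n.+1)) =
    \sum_(i | P i) \sum_(j | P j) (a i - a j) * (a i ^+ n.+1 - a j ^+ n.+1).
  have -> : \sum_(i | P i) \sum_(j | P j) (a i - a j) * (a i ^+ n.+1 - a j ^+ n.+1) =
     \sum_(i | P i) \sum_(j | P j) (a i ^+ n.+2 + a j ^+ n.+2)
     - (\sum_(i | P i) \sum_(j | P j) a i * a j ^+ n.+1
       + \sum_(i | P i) \sum_(j | P j) a j * a i ^+ n.+1).
    rewrite -big_split -sumrB; apply: eq_bigr => i _.
    rewrite -big_split -sumrB; apply: eq_bigr => j _ /=.
    by rewrite ![_ ^+ n.+2]exprS; ring.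
  have -> : \sum_(i | P i) \sum_(j | P j) a j * a i ^+ n.+1 =
            \sum_(i | P i) \sum_(j | P j) a i * a j ^+ n.+1 by rewrite exchange_big.
  under [X in _ = X - _]eq_bigr do rewrite big_split /= sumr_const.
  rewrite big_split /= sumr_const sumrMnl.
  have -> : \sum_(i | P i) \sum_(j | P j) a i * a j ^+ n.+1 =
      (\sum_(i | P i) a i) * (\sum_(i | P i) a i ^+ n.+1).
    by rewrite mulr_suml; apply: eq_bigr => i _; rewrite mulr_sumr.
  by rewrite -mulr_natl; ring.
apply: sumr_ge0 => i Pi; apply: sumr_ge0 => j Pj.
rewrite subrXX mulrA -expr2 mulr_ge0 //.
  by rewrite real_exprn_even_ge0 // rpredB // ger0_real ?a0.
by apply: sumr_ge0 => l _; rewrite mulr_ge0 // exprn_ge0 ?a0.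
Qed.

(** A nontrivial additive character; nontriviality is recorded in the form in which it is used, the
    orthogonality relation. *)
Definition primitive_char (F : finFieldType) (C : numClosedFieldType) (e : F -> C) :=
  [/\ {morph e : x y / x + y >-> x * y}, forall x, `|e x| = 1
    & forall w, w != 0 -> \sum_v e (v * w) = 0].

Lemma char0 (F : finFieldType) (C : numClosedFieldType) (e : F -> C) :
  primitive_char e -> e 0 = 1.
Proof.
case=> eD e1 _; have := eD 0 0; rewrite addr0 -{1}(mulr1 (e 0)) => /mulfI -> //.
by rewrite -normr_gt0 e1.
Qed.

Lemma charN (F : finFieldType) (C : numClosedFieldType) (e : F -> C) x :
  primitive_char e -> e (- x) = (e x)^*.
Proof.
move=> eP; case: (eP) => eD e1 _; have x0 : e x != 0 by rewrite -normr_gt0 e1.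
by apply: (mulfI x0); rewrite -eD subrr (char0 eP) -normCK e1 expr1n.
Qed.

(** Multiplicative counterpart of [signed]: negating the argument of a character conjugates its
    value. *)
Definition signed_conj (C : numClosedFieldType) (s : bool) (z : C) := if s then z else z^*.

Lemma norm_exp_prod (C : numClosedFieldType) (z : C) k :
  `|z| ^+ (2 * k) = \prod_(j : bool * 'I_k) signed_conj j.1 z.
Proof.
rewrite exprM normCK exprMn -(pair_big xpredT xpredT (fun b (i : 'I_k) => signed_conj b z)) /=.
by rewrite big_bool /= !prodr_const card_ord.
Qed.

(** The power is a product of k copies of the sum and k copies of its conjugate. Expanding it and
    summing over v, orthogonality keeps exactly the tuples with vanishing signed sum. *)
Lemma moment_eq (F : finFieldType) (C : numClosedFieldType) (e : F -> C) k (I : finType)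
    (P : pred I) (phi : I -> F) (c : I -> C) : primitive_char e ->
  \sum_v `|\sum_(i | P i) c i * e (v * phi i)| ^+ (2 * k) =
  #|F|%:R * \sum_(f : {ffun bool * 'I_k -> I} |
     (f \in ffun_on P) && (\sum_j signed j.1 (phi (f j)) == 0))
     \prod_j signed_conj j.1 (c (f j)).
Proof.
move=> eP; case: (eP) => eD _ eS.
pose cc f := \prod_(j : bool * 'I_k) signed_conj j.1 (c (f j)).
pose sg (f : {ffun bool * 'I_k -> I}) := \sum_j signed j.1 (phi (f j)).
have Ev v : `|\sum_(i | P i) c i * e (v * phi i)| ^+ (2 * k) =
    \sum_(f in ffun_on P) cc f * e (v * sg f).
  rewrite norm_exp_prod.
  rewrite (eq_bigr (fun j => \sum_(i | P i) signed_conj j.1 (c i) * e (v * signed j.1 (phi i)))).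
    rewrite bigA_distr_big; apply: eq_bigr => f _; rewrite big_split; congr (_ * _).
    rewrite mulr_sumr; symmetry.
    exact: (big_morph e eD (char0 eP)).
  move=> [[] j] _ //=; rewrite rmorph_sum; apply: eq_bigr => i _ /=.
  by rewrite rmorphM /= mulrN (charN _ eP).
under eq_bigr do rewrite Ev.
rewrite exchange_big /= mulr_sumr big_mkcondr /=; apply: eq_bigr => f _.
rewrite -mulr_sumr; case: eqP => [e0|/eqP n0]; last by rewrite eS ?mulr0.
rewrite mulrC; congr (_ * _); rewrite (eq_bigr (fun=> 1)) ?sumr_const //.
by move=> v _; rewrite /sg e0 mulr0 (char0 eP).
Qed.

Lemma moment_zero_sums (F : finFieldType) (C : numClosedFieldType) (e : F -> C) k (I : finType)
    (P : pred I) (phi : I -> F) : primitive_char e ->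
  \sum_v `|\sum_(i | P i) e (v * phi i)| ^+ (2 * k) = (#|F| * zero_sums k P phi)%:R.
Proof.
move=> eP; under eq_bigr do under eq_bigr do rewrite -[e _]mul1r.
rewrite (moment_eq k P phi (fun=> 1) eP) natrM; congr (_ * _).
rewrite /zero_sums -sum1_card natr_sum; apply: eq_big => f; first by rewrite inE.
by move=> _; rewrite big1 // => -[[] j] _ //=; rewrite /signed_conj rmorph1.
Qed.

(** Majorant principle: in the expansion each solution carries a product of coefficients of modulus
    at most 1. *)
Lemma moment_le (F : finFieldType) (C : numClosedFieldType) (e : F -> C) k (I : finType)
    (P : pred I) (phi : I -> F) (c : I -> C) : primitive_char e ->
  (forall i, P i -> `|c i| <= 1) ->
  \sum_v `|\sum_(i | P i) c i * e (v * phi i)| ^+ (2 * k) <= (#|F| * zero_sums k P phi)%:R.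
Proof.
move=> eP c1; have h0 : 0 <= \sum_v `|\sum_(i | P i) c i * e (v * phi i)| ^+ (2 * k).
  by apply: sumr_ge0 => v _; rewrite exprn_ge0.
rewrite -(ger0_norm h0) moment_eq // normrM normr_nat natrM ler_wpM2l //.
apply: le_trans (ler_norm_sum _ _ _) _.
rewrite /zero_sums -sum1_card natr_sum; apply: ler_sum => f /andP[/ffun_onP fP _].
rewrite normr_prod; apply: prodr_ile1 => -[s j] _; rewrite normr_ge0 /=.
by case: s; rewrite /signed_conj ?norm_conjC c1 //; exact: fP.
Qed.

(** On the left the 2k variables may use different z, on the right they share one. The count is
    turned into a moment, the power mean inequality is applied to the sum over z for each v, and the
    moments are turned back into counts. *)
Lemma zero_sums_average (F : finFieldType) (C : numClosedFieldType) (e : F -> C) k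
    (Z Y : finType) (PZ : pred Z) (P : Z -> pred Y) (phi : Z -> Y -> F) :
  (0 < k)%N -> primitive_char e ->
  (zero_sums k [pred i : Z * Y | PZ i.1 && P i.1 i.2] (fun i => phi i.1 i.2) <=
   #|PZ| ^ (2 * k).-1 * \sum_(z | PZ z) zero_sums k (P z) (phi z))%N.
Proof.
move=> k0 eP; have F0 : (0 < #|F|)%N by apply/card_gt0P; exists 0.
rewrite -(leq_pmul2l F0) -(ler_nat C) -(moment_zero_sums _ _ _ eP).
have -> : (#|F| * (#|PZ| ^ (2 * k).-1 * \sum_(z | PZ z) zero_sums k (P z) (phi z)))%:R =
  #|PZ|%:R ^+ (2 * k).-1 * \sum_v \sum_(z | PZ z) `|\sum_(y | P z y) e (v * phi z y)| ^+ (2 * k) :> C.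
  rewrite exchange_big /= mulnCA natrM natrX; congr (_ * _).
  by rewrite big_distrr natr_sum; apply: eq_bigr => z _; rewrite moment_zero_sums.
rewrite mulr_sumr; apply: ler_sum => v _.
rewrite -(pair_big_dep PZ P (fun z y => e (v * phi z y))) /=.
have -> : (2 * k = (2 * k).-1.+1)%N by lia.
apply: le_trans (power_mean _ _); last by [].
by apply: lerXn2r; rewrite ?nnegrE ?sumr_ge0 ?ler_norm_sum.
Qed.

(** * The shifted equation *)

(** Some value is attained exactly once; the pole that it contributes to the sum of inverse powers
    cannot cancel. *)
Definition has_simple_value (J Y : finType) (f : {ffun J -> Y}) :=
  [exists j, [forall i, (f i == f j) ==> (i == j)]].

(* Without simple values [f] takes at most [k] values, so it factors through ['I_k]. *)
Lemma card_no_simple_value k (J Y : finType) : #|J| = (2 * k)%N -> (0 < k)%N ->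
  (#|[pred f : {ffun J -> Y} | ~~ has_simple_value f]| <= k ^ (2 * k) * #|Y| ^ k)%N.
Proof.
move=> cJ k0.
pose cmp (gh : {ffun 'I_k -> Y} * {ffun J -> 'I_k}) : {ffun J -> Y} := [ffun j => gh.1 (gh.2 j)].
have -> : (k ^ (2 * k) * #|Y| ^ k = #|{: {ffun 'I_k -> Y} * {ffun J -> 'I_k}}|)%N.
  by rewrite card_prod !card_ffun !card_ord cJ mulnC.
apply: leq_trans (leq_image_card cmp _); apply: subset_leq_card.
apply/fintype.subsetP => f; rewrite inE negb_exists => /forallP nf.
have [j0 _] : exists j0, j0 \in J by apply/card_gt0P; rewrite cJ; lia.
pose s := enum [pred y in codom f].
have mem_s j : f j \in s by rewrite mem_enum inE codom_f.
have sk : (size s <= k)%N.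
  rewrite -(leq_pmul2l (isT : (0 < 2)%N)) -cJ -cardE -[#|J|]sum1_card.
  rewrite (partition_big f [pred y in codom f]) /= => [|i _]; last exact: codom_f.
  rewrite mulnC -sum_nat_const; apply: leq_sum => y /codomP[j ->].
  have := nf j; rewrite negb_forall => /existsP[l]; rewrite negb_imply => /andP[ij ni].
  by rewrite (bigD1 l) //= (bigD1 j) ?eqxx //= eq_sym.
pose g : {ffun 'I_k -> Y} := [ffun i : 'I_k => nth (f j0) s i].
have hlt j : (index (f j) s < k)%N by apply: leq_trans sk; rewrite index_mem.
pose h : {ffun J -> 'I_k} := [ffun j => Ordinal (hlt j)].
apply/fintype.imageP; exists (g, h) => //; apply/ffunP => j; rewrite !ffunE /=.
by rewrite nth_index.
Qed.

(** The numerator of the sum of [s j / ('X + c j) ^ d] over the common denominator, the product of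
    all [('X + c i) ^ d]. *)
Definition cleared_sum (F : fieldType) (J : finType) (s c : J -> F) d : {poly F} :=
  \sum_j s j *: \prod_(i | i != j) ('X + (c i)%:P) ^+ d.

Lemma size_cleared_sum (F : fieldType) (J : finType) (s c : J -> F) d :
  (size (cleared_sum s c d) <= (#|J| * d).+1)%N.
Proof.
apply: (leq_trans (size_sum _ _ _)); apply/bigmax_leqP => j _.
apply: leq_trans (size_scale_leq _ _) _.
have aux r : (size (\prod_(i <- r | i != j) ('X + (c i)%:P) ^+ d)%R <= (size r * d).+1)%N.
  elim: r => [|i r IH]; first by rewrite big_nil size_poly1.
  rewrite big_cons; case: ifP => _; last by apply: leq_trans IH _; rewrite /= mulSn; lia.
  have h : (size (('X + (c i)%:P) ^+ d)%R <= d.+1)%N.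
    by apply: leq_trans (size_exp_leq _ _) _; rewrite size_XaddC /= mul1n.
  apply: leq_trans (size_polyMleq _ _) _; rewrite -subn1 leq_subLR.
  by apply: leq_trans (leq_add h IH) _; rewrite /= mulSn; lia.
by rewrite cardT enumT; exact: aux.
Qed.

(** At [- c j0] every term but that of [j0] has a vanishing factor, while the term of [j0] is a
    product of nonzero elements. *)
Lemma cleared_sum_neq0 (F : fieldType) (J : finType) (s c : J -> F) d j0 : (0 < d)%N ->
  (forall j, s j != 0) -> (forall j, j != j0 -> c j != c j0) -> cleared_sum s c d != 0.
Proof.
move=> d0 s0 cj; apply/eqP => /(congr1 (horner_eval (- c j0))).
rewrite /horner_eval horner0 /cleared_sum horner_sum (bigD1 j0) //= [X in _ + X]big1 ?addr0 => [|j nj].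
  rewrite hornerZ horner_prod => /eqP; rewrite mulf_eq0 (negPf (s0 _)) /=.
  apply/negP/prodf_neq0 => i ni; rewrite horner_exp expf_neq0 // hornerD hornerX hornerC.
  by rewrite addrC subr_eq0 cj.
rewrite hornerZ horner_prod (bigD1 j0) /= 1?eq_sym // horner_exp hornerD hornerX hornerC.
by rewrite addNr expr0n eqn0Ngt d0 mul0r mulr0.
Qed.

(** Such t are roots of the nonzero polynomial [cleared_sum], of degree at most [#|J| * d]. *)
Lemma card_roots_sum_inv (F : finFieldType) (J : finType) (s c : J -> F) d j0 : (0 < d)%N ->
  (forall j, s j != 0) -> (forall j, j != j0 -> c j != c j0) ->
  (#|[pred t : F | [forall j, (t + c j != 0)%R] && (\sum_j s j * (t + c j) ^- d == 0)%R]| <= #|J| * d)%N.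
Proof.
move=> d0 s0 cj; rewrite -ltnS; apply: leq_trans (size_cleared_sum s c d).
rewrite cardE; apply: max_poly_roots (enum_uniq _).
  exact: cleared_sum_neq0 d0 s0 cj.
apply/allP => t; rewrite mem_enum inE => /andP[/forallP t0 /eqP ts].
rewrite rootE /cleared_sum horner_sum; apply/eqP.
transitivity (\prod_i (t + c i) ^+ d * \sum_j s j * (t + c j) ^- d); last by rewrite ts mulr0.
rewrite mulr_sumr; apply: eq_bigr => j _.
rewrite hornerZ horner_prod [in RHS](bigD1 j) //= mulrCA [_ ^+ d * _]mulrC mulfK ?expf_neq0 //.
congr (_ * _).
by apply: eq_bigr => i _; rewrite horner_exp hornerD hornerX hornerC.
Qed.

(** The tuple is fixed first and the z are counted. A tuple without simple value is charged all of
    [PZ]; any other one admits at most 2kd values of t, each coming from at most M elements z. *)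
Lemma sum_zero_sums_shift (F : finFieldType) k d (Z Y : finType) (PZ : pred Z) (tau : Z -> F)
    (iota : Y -> F) M :
  (0 < k)%N -> (0 < d)%N -> injective iota ->
  (forall t, (#|[pred z | PZ z && (tau z == t)]| <= M)%N) ->
  (\sum_(z | PZ z) zero_sums k [pred y | (tau z + iota y != 0)%R] (fun y => ((tau z + iota y) ^- d)%R)
   <= #|PZ| * (k ^ (2 * k) * #|Y| ^ k) + M * (2 * k * d) * #|Y| ^ (2 * k))%N.
Proof.
move=> k0 d0 iI hM; rewrite /zero_sums.
pose A (t : F) (f : {ffun bool * 'I_k -> Y}) := [forall j, t + iota (f j) != 0] &&
  (\sum_(j : bool * 'I_k) signed j.1 1 * (t + iota (f j)) ^- d == 0).
have EA z : #|[pred f : {ffun bool * 'I_k -> Y} | (f \in ffun_on [pred y | tau z + iota y != 0]) &&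
     (\sum_j signed j.1 ((tau z + iota (f j)) ^- d) == 0)]| = (\sum_f A (tau z) f)%N.
  rewrite -sum1_card big_mkcond /=; apply: eq_bigr => f _; rewrite inE /A.
  have -> : (f \in ffun_on [pred y | tau z + iota y != 0]) = [forall j, tau z + iota (f j) != 0].
    by apply/ffun_onP/forallP => h j; have := h j; rewrite inE.
  have -> : \sum_j signed j.1 ((tau z + iota (f j)) ^- d) =
            \sum_j signed j.1 1 * (tau z + iota (f j)) ^- d.
    by apply: eq_bigr => j _; rewrite -[X in signed _ X]mulr1 signedM mulrC.
  by case: (_ && _).
under eq_bigr do rewrite EA.
rewrite exchange_big /= (bigID (fun f => ~~ has_simple_value f)) /=; apply: leq_add.
  rewrite mulnC; apply: (@leq_trans (\sum_(f : {ffun bool * 'I_k -> Y} | ~~ has_simple_value f) #|PZ|)%N).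
    by apply: leq_sum => f _; rewrite -sum1_card; apply: leq_sum => z _; case: (A _ _).
  by rewrite sum_nat_const leq_mul2r card_no_simple_value ?orbT // card_bool_ord.
rewrite mulnC; apply: (@leq_trans (\sum_(f : {ffun bool * 'I_k -> Y}) M * (2 * k * d))%N).
  rewrite big_mkcond; apply: leq_sum => f _; case: ifP => //; rewrite negbK => /existsP[j0 /forallP hj].
  rewrite (partition_big tau xpredT) //=.
  apply: (@leq_trans (\sum_t A t f * M)%N).
    apply: leq_sum => t _; rewrite mulnC; apply: leq_trans (leq_mul (hM t) (leqnn _)).
    rewrite -sum1_card big_distrl /=; apply: leq_sum => z /andP[_ /eqP ->].
    by rewrite mul1n.
  rewrite -big_distrl /= mulnC leq_mul2l; apply/orP; right.
  rewrite -card_bool_ord; apply: leq_trans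
    (@card_roots_sum_inv F _ (fun j => signed j.1 1) (fun j => iota (f j)) d j0 d0 _ _).
  - by rewrite -sum1_card [leqRHS]big_mkcond; apply: leq_sum => t _; rewrite inE -/(A t f); case: (A t f).
  - by case=> [[] j]; rewrite /signed /= ?oppr_eq0 oner_eq0.
  - by move=> j; apply: contra => /eqP/iI h; have := hj j; rewrite h eqxx.
by rewrite sum_nat_const card_ffun card_bool_ord.
Qed.

Lemma eq_zero_sums (V : zmodType) k (I : finType) (P : pred I) (phi psi : I -> V) :
  phi =1 psi -> zero_sums k P phi = zero_sums k P psi.
Proof.
by move=> e; apply: eq_card => f; rewrite !inE; under eq_bigr do rewrite e.
Qed.

(** * Shifts by products *)

Lemma ltn_Fp p (x : 'F_p) : prime p -> (val x < p)%N.
Proof. by move=> pP; have := ltn_ord x; rewrite [X in (_ < X)%N]Fp_cast. Qed.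

Lemma natr_Fp_inj p m n : prime p -> (m < p)%N -> (n < p)%N -> m%:R = n%:R :> 'F_p -> m = n.
Proof.
move=> pP mp np /(congr1 val); rewrite /= !val_Fp_nat //.
by rewrite !modn_small.
Qed.

Lemma natr_Fp_neq0 p n : prime p -> (0 < n < p)%N -> n%:R != 0 :> 'F_p.
Proof.
move=> pP /andP[n0 np]; apply/eqP => /(@natr_Fp_inj p n 0 pP np (prime_gt0 pP)) e.
by rewrite e in n0.
Qed.

(** The points (x, i x) fall into m * m cells, so two of them share a cell and are close in both
    coordinates. Dividing by [X.+1] and [W.+1] keeps the cell indices below m even when x = X or i x
    = W. *)
Lemma pigeonhole_square m X W (A : pred 'I_X.+1) (i : 'I_X.+1 -> nat) : (0 < m)%N ->
  (forall x, A x -> (i x <= W)%N) -> (m ^ 2 < #|A|)%N ->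
  exists x1 x2, [/\ A x1, A x2, (x1 < x2)%N, ((x2 - x1) * m <= X)%N
    & (i x2 * m <= i x1 * m + W)%N && (i x1 * m <= i x2 * m + W)%N].
Proof.
case: m => // m _ iW cA.
pose cell (x : 'I_X.+1) : 'I_m.+1 * 'I_m.+1 :=
  (inord (x * m.+1 %/ X.+1), inord (i x * m.+1 %/ W.+1)).
case: (pickP [pred z : 'I_X.+1 * 'I_X.+1 | [&& A z.1, A z.2, (z.1 < z.2)%N & cell z.1 == cell z.2]]);
  last first.
  move=> none; exfalso; move: cA; apply/negP; rewrite -leqNgt.
  have -> : (m.+1 ^ 2 = #|{: 'I_m.+1 * 'I_m.+1}|)%N by rewrite card_prod card_ord -mulnn.
  apply: (@leq_card_in _ _ cell) => x y xA yA e.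
  have h1 := none (x, y); have h2 := none (y, x); move: h1 h2; rewrite /= e eqxx !andbT.
  rewrite [A x]xA [A y]yA /=.
  by case: (ltngtP x y) => // h _ _; apply: val_inj.
move=> [x1 x2] /= /and4P[A1 A2 lt /eqP[]] /(congr1 val) /= e1 /(congr1 val) /= e2.
exists x1, x2; split=> //.
  rewrite !inordK ?ltn_divLR ?ltn_pmul2r // in e1; [|rewrite mulnC ltn_pmul2l //..].
  have d1 := divn_eq (x1 * m.+1) X.+1; have d2 := divn_eq (x2 * m.+1) X.+1.
  rewrite mulnBl d2 d1 e1; have := ltn_pmod (x2 * m.+1) (ltn0Sn X); lia.
rewrite !inordK in e2; [|rewrite ltn_divLR // mulnC ltn_pmul2l // ltnS iW //..].
have d1 := divn_eq (i x1 * m.+1) W.+1; have d2 := divn_eq (i x2 * m.+1) W.+1.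
rewrite d2 d1 e2; have := ltn_pmod (i x2 * m.+1) (ltn0Sn W).
have := ltn_pmod (i x1 * m.+1) (ltn0Sn W); lia.
Qed.

Section Shifts.
Variables (p U X L : nat) (s : 'F_p).

(* [t = (i + s) / x] for some integer [i] with [-U <= i <= U]. *)
Definition near_multiple (x : nat) (t : 'F_p) := (val (t * x%:R - (s - U%:R))%R <= 2 * U)%N.

Definition multiplicity (t : 'F_p) :=
  #|[pred x : 'I_X.+1 | prime_or_one x && near_multiple x t]|.

(** With this value at most [X %/ cutoff * (2 * L)] <= X / (6 L) of the x get discarded, half of the
    lower bound X / (3 L) for their number. *)
Definition cutoff := (12 * L ^ 2)%N.

Definition good_pair (z : 'I_X.+1 * 'F_p) :=
  [&& prime_or_one z.1, near_multiple z.1 z.2 & (multiplicity z.2 <= cutoff ^ 2)%N].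

(** The residues of B w and - B w do not depend on x. Both signs occur because the multiple of x
    congruent to B w may be a negative integer. *)
Definition exceptional (w : 'F_p) (x : nat) :=
  [exists B : 'I_(X %/ cutoff), (x %| val (B.+1%:R * w)%R) || (x %| val (- (B.+1%:R * w))%R)]%N.

(** Two close [x1 < x2] with t near their multiples give t B = j2 - j1 for B = x2 - x1. Substituting
    t = w / x - y yields B w = (j2 + B y - j1) x, whose right-hand side is smaller than p in
    absolute value and hence is the representative of B w or minus that of - B w. *)
Lemma exceptional_of_multiplicity (w : 'F_p) x y : prime p -> (0 < L)%N -> (X * U <= p)%N ->
  (X < p)%N -> (0 < x <= X)%N -> (X * y <= U)%N ->
  (cutoff ^ 2 < multiplicity (w / x%:R - y%:R)%R)%N -> exceptional w x.
Proof.
move=> pP L0 XUp Xp /andP[x0 xX] yU; set t := w / _ - _ => big.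
have xF : x%:R != 0 :> 'F_p by rewrite natr_Fp_neq0 // x0 (leq_ltn_trans xX).
have m4 : (3 < cutoff)%N by rewrite /cutoff; have := expn_gt0 L 2; rewrite L0; lia.
have [|x1 [x2 [A1 A2 lt Bm /andP[i1 i2]]]] := pigeonhole_square
  (i := fun x : 'I_X.+1 => val (t * x%:R - (s - U%:R))%R) (W := (2 * U)%N) (ltnW (ltnW (ltnW m4))) _ big.
  by move=> z /andP[].
move: i1 i2; set j2 := val _; set j1 := val _ => i1 i2.
pose B := (x2 - x1)%N; have B0 : (0 < B)%N by rewrite subn_gt0.
have Bp : (0 < X %/ cutoff)%N by rewrite divn_gt0 ?(leq_trans _ Bm) ?leq_pmull //; lia.
have Blt : (B.-1 < X %/ cutoff)%N by rewrite prednK // leq_divRL //; lia.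
have ej n (z : 'I_X.+1) : n = val (t * z%:R - (s - U%:R))%R -> n%:R = t * z%:R - (s - U%:R).
  by move=> ->; rewrite natr_Zp.
have eB : B%:R * w = (j2%:R + (B * y)%:R - j1%:R) * x%:R.
  rewrite (ej j2 x2) // (ej j1 x1) // natrM /B natrB 1?ltnW //.
  rewrite -[X in _ * X = _](divfK xF w) mulrA; congr (_ * _).
  by rewrite /t; ring.
(* The bound 3 U consists of 2 U for the difference of j1 and j2 and U for B y; as X U <= p, any
   cutoff above 3 then forces n x < p. *)
have bnd n : (n * cutoff <= 3 * U)%N -> (n * x < p)%N.
  move=> h; rewrite -(@ltn_pmul2r cutoff); last by lia.
  apply: leq_ltn_trans (_ : (3 * p < _)%N); last by rewrite mulnC ltn_pmul2l // prime_gt0.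
  rewrite mulnAC; apply: leq_trans (leq_mul h xX) _; lia.
have Bym : (B * y * cutoff <= U)%N.
  by rewrite mulnAC; apply: leq_trans yU; rewrite leq_mul2r Bm orbT.
have eo : (Ordinal Blt).+1 = B by exact: prednK.
apply/existsP; exists (Ordinal Blt); rewrite eo eB -natrD.
have [le|gt] := leqP j1 (j2 + B * y).
  have nb : ((j2 + B * y - j1) * x < p)%N by apply: bnd; rewrite mulnBl mulnDl; lia.
  by apply/orP; left; rewrite -natrB // -natrM /= val_Fp_nat // modn_small // dvdn_mull.
have nb : ((j1 - (j2 + B * y)) * x < p)%N by apply: bnd; rewrite mulnBl mulnDl; lia.
apply/orP; right; rewrite -mulNr opprB -natrB 1?ltnW // -natrM /= val_Fp_nat // modn_small //.
by rewrite dvdn_mull.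
Qed.

(** There are 2 (X / cutoff) residues, all nonzero because B < p, and each has at most L divisors
    that are prime or 1. *)
Lemma card_exceptional (w : 'F_p) : prime p -> w != 0 -> (X < p)%N -> (p < 2 ^ L)%N ->
  (#|[pred x : 'I_X.+1 | prime_or_one x && exceptional w x]| <= X %/ cutoff * (2 * L))%N.
Proof.
move=> pP w0 Xp pL.
pose D (r : 'F_p) := [pred x : 'I_X.+1 | prime_or_one x && (x %| val r)%N].
have cD r : r != 0 -> (#|D r| <= L)%N.
  move=> r0; apply: card_prime_or_one_dvd; rewrite (leq_ltn_trans _ pL) ?andbT; last exact: ltnW (ltn_Fp _ pP).
  by rewrite lt0n; apply: contra r0 => /eqP h; apply/eqP/val_inj.
rewrite -[X in (_ <= X * _)%N]card_ord -sum_nat_const.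
apply: (@leq_trans (\sum_(B : 'I_(X %/ cutoff)) (#|D (B.+1%:R * w)%R| + #|D (- (B.+1%:R * w))%R|))%N).
  have cs (A : pred 'I_X.+1) : #|A| = (\sum_x A x)%N.
    by rewrite -sum1_card big_mkcond; apply: eq_bigr => x _; rewrite unfold_in; case: (A x).
  rewrite [leqRHS](eq_bigr (fun B : 'I_(X %/ cutoff) =>
    (\sum_x (D (B.+1%:R * w)%R x + D (- (B.+1%:R * w))%R x))%N)); last first.
    by move=> B _; rewrite big_split /= !cs.
  rewrite exchange_big cs; apply: leq_sum => x _ /=.
  case: (boolP (_ && _)) => // /andP[xq /existsP[B hB]]; rewrite (bigD1 B) //=.
  by rewrite xq /=; case/orP: hB => ->; rewrite ?addn1; lia.
apply: leq_sum => B _; have h : B.+1%:R * w != 0.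
  rewrite mulf_neq0 // natr_Fp_neq0 //= (leq_ltn_trans (ltn_ord B)) //.
  exact: leq_ltn_trans (leq_div _ _) Xp.
by rewrite mul2n -addnn leq_add // cD ?oppr_eq0.
Qed.

(** The pair is recovered from x and from the residue in [0, 2 U] that makes t near x. *)
Lemma card_good_pair : prime p -> (X < p)%N ->
  (#|[pred z | good_pair z]| <= X * (2 * U).+1)%N.
Proof.
move=> pP Xp.
pose g (a : 'I_X * 'I_(2 * U).+1) : 'I_X.+1 * 'F_p :=
  (lift ord0 a.1, (a.2%:R + (s - U%:R)) / a.1.+1%:R).
have -> : (X * (2 * U).+1 = #|{: 'I_X * 'I_(2 * U).+1}|)%N by rewrite card_prod !card_ord.
apply: leq_trans (leq_image_card g _); apply: subset_leq_card; apply/fintype.subsetP => -[x t].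
rewrite inE => /and3P[/= xq nm _].
have x0 : (0 < x)%N by move: xq => /orP[/eqP->|/prime_gt0].
have x1 : (x.-1 < X)%N by have := ltn_ord x; lia.
have xF : x%:R != 0 :> 'F_p.
  by rewrite natr_Fp_neq0 // x0 /=; apply: leq_ltn_trans Xp; rewrite -ltnS.
have et : ((val (t * x%:R - (s - U%:R))%R)%:R + (s - U%:R)) / x%:R = t.
  by rewrite natr_Zp addrNK mulfK.
have ex : lift ord0 (Ordinal x1) = x by apply: val_inj; rewrite /= /bump /= add1n prednK.
apply/fintype.imageP; exists (Ordinal x1, Ordinal (nm : (_ < (2 * U).+1)%N)) => //.
by rewrite /g [(_, _).1]/= [(_, _).2]/= ex -[in LHS]et /= prednK.
Qed.

Lemma card_good_pair_fibre t : (#|[pred z | good_pair z && (z.2 == t)]| <= cutoff ^ 2)%N.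
Proof.
have [h|h] := leqP (multiplicity t) (cutoff ^ 2); last first.
  rewrite eq_card0 // => z; rewrite inE /good_pair; apply/negP => /andP[/and3P[_ _ hz] /eqP e].
  by rewrite e leqNgt h in hz.
apply: leq_trans h; rewrite /multiplicity -(fintype.card_image (f := fun x : 'I_X.+1 => (x, t))).
  apply: subset_leq_card; apply/fintype.subsetP => -[x t'] /andP[/and3P[h1 h2 _] /eqP /= e].
  by subst t'; apply: fintype.image_f; rewrite inE h1.
by move=> x y [].
Qed.

(** Each non-exceptional x and each y < Y give a representation with t = w / x - y, and distinct (x,
    y) give distinct ones. *)
Lemma card_representations (w : 'F_p) (u Y : nat) : prime p -> (0 < L)%N -> (X * U <= p)%N ->
  (X < p)%N -> (p < 2 ^ L)%N -> (X * Y <= U)%N -> (0 < u <= U)%N ->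
  w = u%:R + s -> w != 0 ->
  ((#|[pred x : 'I_X.+1 | prime_or_one x]| - X %/ cutoff * (2 * L)) * Y <=
   #|[pred a : ('I_X.+1 * 'F_p)%type * 'I_Y | [&& good_pair a.1, a.1.2 + a.2%:R != 0 &
        a.1.1%:R * (a.1.2 + a.2%:R) == w]%R]|)%N.
Proof.
move=> pP L0 XUp Xp pL XY /andP[u0 uU] ew w0.
pose G := [pred x : 'I_X.+1 | prime_or_one x && ~~ exceptional w x].
pose g (a : 'I_X.+1 * 'I_Y) := ((a.1, w / a.1%:R - a.2%:R), a.2).
have gI : injective g by move=> [x y] [x' y'] [-> _ ->].
apply: (@leq_trans #|[pred a : 'I_X.+1 * 'I_Y | G a.1]|).
  have -> : #|[pred a : 'I_X.+1 * 'I_Y | G a.1]| = (#|G| * Y)%N.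
    rewrite -[X in (_ * X)%N](card_ord Y) -cardX; apply: eq_card => a; rewrite !inE andbT //.
  rewrite leq_mul2r; apply/orP; right; rewrite leq_subLR.
  apply: leq_trans (leq_add (card_exceptional pP w0 Xp pL) (leqnn _)).
  rewrite -cardUI; apply: leq_trans (leq_addr _ _); apply: subset_leq_card; apply/fintype.subsetP => x.
  by rewrite !inE => ->; case: (exceptional w x).
rewrite -(fintype.card_image gI); apply: subset_leq_card; apply/fintype.subsetP => _ /fintype.imageP[[x y] + ->].
rewrite !inE /= => /andP[xq xe].
have x0 : (0 < x)%N by move: xq => /orP[/eqP->|/prime_gt0].
have xX : (x <= X)%N by rewrite -ltnS.
have xF : x%:R != 0 :> 'F_p by rewrite natr_Fp_neq0 // x0 (leq_ltn_trans xX).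
have yU : (X * y <= U)%N by apply: leq_trans XY; rewrite leq_mul2l ltnW ?orbT.
rewrite /g /= subrK mulrCA divff // mulr1 eqxx andbT mulf_neq0 ?invr_eq0 // andbT.
apply/and3P; split=> //=; last first.
  rewrite leqNgt; apply: contra xe => /exceptional_of_multiplicity; apply=> //.
  by rewrite x0.
rewrite /near_multiple.
(* As 0 <= x y <= U, adding U makes u - x y a natural number, at most 2 U. *)
have -> : (w / x%:R - y%:R) * x%:R - (s - U%:R) = (u + U - x * y)%:R :> 'F_p.
  rewrite natrB ?natrD ?natrM; last by have := leq_mul xX (leqnn y); lia.
  rewrite mulrBl divfK // ew; ring.
rewrite /= val_Fp_nat //; apply: leq_trans (leq_mod _ _) _; lia.
Qed.

End Shifts.

(** * The number of solutions of the equation with reciprocal powers *)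

Definition moment_const (k d : nat) := (3 * 2 ^ k * k ^ (2 * k) + 288 * k * d)%N.

(** The condition on X gives X U <= (U / X) ^ k <= (2 Y) ^ k, so the diagonal term N Y ^ k is
    dominated by a multiple of Y ^ (2 k). In [moment_const], 3 * 2 ^ k comes from this and N <= 3 X
    U, and 288 from 2 times 144, where [cutoff L ^ 2 = 144 * L ^ 4]. *)
Lemma moment_arith k d U X Y L N g J :
  (0 < k)%N -> (0 < L)%N -> (0 < X <= U)%N -> (0 < Y)%N -> (U <= 2 * (X * Y))%N ->
  (X ^ k.+1 <= U ^ k.-1)%N -> (X <= 6 * L * g)%N -> (N <= 3 * (X * U))%N ->
  ((g * Y) ^ (2 * k) * J <=
     N ^ (2 * k).-1 * (N * (k ^ (2 * k) * Y ^ k) + cutoff L ^ 2 * (2 * k * d) * Y ^ (2 * k)))%N ->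
  (X * J <= (6 * L) ^ (2 * k) * (3 * U) ^ (2 * k).-1 * (moment_const k d * L ^ 4))%N.
Proof.
move=> k0 L0 /andP[X0 XU] Y0 UY hX hg hN h.
have XUY : (X * U <= 2 ^ k * Y ^ k)%N.
  have Xk : (0 < X ^ k)%N by rewrite expn_gt0 X0.
  rewrite -(leq_pmul2r Xk); apply: (@leq_trans (U ^ k)).
    rewrite mulnAC -expnS -{2}(prednK k0) (expnSr U); exact: leq_mul.
  have -> : (2 ^ k * Y ^ k * X ^ k = (2 * (X * Y)) ^ k)%N by rewrite -!expnMn; congr (_ ^ _)%N; lia.
  by rewrite leq_exp2r.
have br : (N * (k ^ (2 * k) * Y ^ k) + cutoff L ^ 2 * (2 * k * d) * Y ^ (2 * k) <=
           moment_const k d * L ^ 4 * Y ^ (2 * k))%N.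
  have -> : (cutoff L ^ 2 = 144 * L ^ 4)%N by rewrite /cutoff expnMn -expnM.
  rewrite /moment_const mulnDl mulnDl; apply: leq_add; last by lia.
  have -> : (Y ^ (2 * k) = Y ^ k * Y ^ k)%N by rewrite mul2n -addnn expnD.
  have L4 : (0 < L ^ 4)%N by rewrite expn_gt0 L0.
  apply: leq_trans (leq_mul hN (leqnn _)) _.
  apply: leq_trans (leq_mul (leq_mul (leqnn 3) XUY) (leqnn _)) _.
  apply: (@leq_trans (3 * 2 ^ k * k ^ (2 * k) * 1 * (Y ^ k * Y ^ k))%N); first by lia.
  by rewrite leq_mul2r leq_mul2l L4 !orbT.
have Y2 : (0 < Y ^ (2 * k))%N by rewrite expn_gt0 Y0.
have h1 : (g ^ (2 * k) * J <= (3 * (X * U)) ^ (2 * k).-1 * (moment_const k d * L ^ 4))%N.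
  rewrite -(leq_pmul2r Y2) mulnAC -expnMn; apply: leq_trans h _.
  by rewrite -[leqRHS]mulnA; apply: leq_mul br; rewrite leq_exp2r //; lia.
have k2 : (0 < 2 * k)%N by rewrite muln_gt0.
have X2 : (0 < X ^ (2 * k).-1)%N by rewrite expn_gt0 X0.
rewrite -(leq_pmul2l X2) mulnA -expnSr prednK // {br XUY h}.
apply: (@leq_trans ((6 * L * g) ^ (2 * k) * J)).
  by rewrite leq_mul2r leq_exp2r ?hg ?orbT.
rewrite expnMn -mulnA; apply: leq_trans (leq_mul (leqnn _) h1) _.
rewrite (mulnCA 3 X U) [((X * _) ^ _)%N]expnMn; apply: eq_leq.
by rewrite -!mulnA mulnCA.
Qed.

(** Every u lifts to at least g Y triples ((x, t), y) with x (t + y) = u + s. Averaging makes (x, t)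
    common to all variables, the factor x ^ - d scales away, and the shifted equation remains. *)
Lemma zero_sums_reciprocal (C : numClosedFieldType) p (e : 'F_p -> C) k d U X L H (s : 'F_p) :
  prime p -> primitive_char e -> (0 < k)%N -> (0 < d)%N -> (0 < U < p)%N -> (p < 2 ^ L)%N ->
  (0 < X)%N -> (X * U <= p)%N -> (X ^ k.+1 <= U ^ k.-1)%N ->
  (X * zero_sums k [pred u : 'I_H | (0 < u <= U)%N && (u%:R + s != 0)%R]
      (fun u : 'I_H => ((u%:R + s) ^- d)%R) <=
   (6 * L) ^ (2 * k) * (3 * U) ^ (2 * k).-1 * (moment_const k d * L ^ 4))%N.
Proof.
move=> pP eP k0 d0 /andP[U0 Up] pL X0 XUp hX.
have L0 : (0 < L)%N by case: (L) pL => //; rewrite expn0 ltnNge prime_gt0.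
(* If X > U, then U ^ (k + 1) < X ^ (k + 1) <= U ^ (k - 1), which is absurd. *)
have XU : (X <= U)%N.
  rewrite leqNgt; apply/negP => h; move: hX; apply/negP; rewrite -ltnNge.
  apply: leq_ltn_trans (_ : U ^ k.+1 < _)%N; last by rewrite ltn_exp2r.
  by rewrite leq_pexp2l //; lia.
have Xp := leq_ltn_trans XU Up.
pose Y := (U %/ X)%N; pose m := cutoff L.
have Y0 : (0 < Y)%N by rewrite divn_gt0.
have XY : (X * Y <= U)%N by rewrite mulnC leq_divM.
pose g := (#|[pred x : 'I_X.+1 | prime_or_one x]| - X %/ m * (2 * L))%N.
pose PZ := [pred z : 'I_X.+1 * 'F_p | good_pair U L s z].
apply: (@moment_arith k d U X Y L #|PZ| g _ k0 L0 _ Y0 _ hX).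
- by rewrite X0.
- by have := divn_eq U X; have := ltn_pmod U X0; have := leq_pmulr X Y0; rewrite /Y; lia.
(* Multiplied by 6 L, the number of primes gives at least 2 X and the discarded ones at most X. *)
- have := @card_prime_or_one X L L0; rewrite X0 /= => /(_ (ltnW (ltn_trans Xp pL))).
  have : (X %/ m * (12 * L ^ 2) <= X)%N by rewrite leq_divM.
  rewrite /g mulnBr; set q := #|_|; set a := (X %/ m)%N; nia.
- apply: leq_trans (card_good_pair _ _ _ pP Xp) _; nia.
apply: (@leq_trans (zero_sums k [pred i : ('I_X.+1 * 'F_p)%type * 'I_Y | PZ i.1 && (i.1.2 + i.2%:R != 0)%R]
    (fun i => ((i.1.1%:R * (i.1.2 + i.2%:R)) ^- d)%R))).
  pose r (u : 'I_H) := [pred a : ('I_X.+1 * 'F_p)%type * 'I_Y |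
     [&& good_pair U L s a.1, a.1.2 + a.2%:R != 0 & a.1.1%:R * (a.1.2 + a.2%:R) == u%:R + s]].
  apply: (@zero_sums_lift _ k _ _ _ _ _ _ r 1).
  - by move=> u a _ /and3P[h1 h2 /eqP h3]; rewrite /= h1 h2 h3 mul1r.
  - move=> u1 u2 a /andP[/andP[_ u1U] _] /andP[/andP[_ u2U] _] /and3P[_ _ /eqP e1] /and3P[_ _ /eqP].
    rewrite e1 => /addIr e12; apply/val_inj/(natr_Fp_inj pP _ _ e12).
      exact: leq_ltn_trans u1U Up.
    exact: leq_ltn_trans u2U Up.
  - by move=> u /andP[uU uw]; exact: (card_representations (u := u)).
apply: leq_trans (zero_sums_average PZ (fun z => [pred y : 'I_Y | z.2 + y%:R != 0])
  (fun z y => (z.1%:R * (z.2 + y%:R)) ^- d) k0 eP) _.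
rewrite leq_mul2l; apply/orP; right.
have YI : injective (fun y : 'I_Y => y%:R : 'F_p).
  move=> y1 y2 /= e12; apply/val_inj/(natr_Fp_inj pP _ _ e12);
    by apply: leq_trans (ltn_ord _) _; apply: leq_trans (ltnW Up); exact: leq_div.
have := @sum_zero_sums_shift _ k d _ _ PZ snd _ (m ^ 2) k0 d0 YI (card_good_pair_fibre U X L s).
rewrite card_ord; apply: leq_trans; apply: leq_sum => z /and3P[zq _ _].
have z0 : z.1%:R != 0 :> 'F_p.
  have zp : (z.1 < p)%N by apply: leq_ltn_trans Xp; rewrite -ltnS.
  by rewrite natr_Fp_neq0 // zp andbT; case/orP: zq => [/eqP->|/prime_gt0].
rewrite -(@zero_sums_scale _ k _ _ (fun y : 'I_Y => (z.2 + y%:R) ^- d) (z.1%:R ^- d)).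
  by apply/eq_leq/eq_zero_sums => y; rewrite exprMn invfM.
by rewrite invr_eq0 expf_neq0.
Qed.

(** * Dyadic decomposition *)

(* Cutting [0, n) according to the binary digits of [n]: at most one block per level. *)
Lemma sum_prefix_dyadic (W : zmodType) L (h : 'I_(2 ^ L) -> W) n : (n < 2 ^ L)%N ->
  \sum_(u : 'I_(2 ^ L) | (u < n)%N) h u =
  \sum_(l < L) if odd (n %/ 2 ^ l) then \sum_(u : 'I_(2 ^ L) | (u %/ 2 ^ l == (n %/ 2 ^ l).-1)%N) h u else 0.
Proof.
move=> nL; pose Q l := \sum_(u : 'I_(2 ^ L) | (u %/ 2 ^ l < n %/ 2 ^ l)%N) h u.
have Q0 : \sum_(u : 'I_(2 ^ L) | (u < n)%N) h u = Q 0%N by apply: eq_bigl => u; rewrite !divn1.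
have QL : Q L = 0 by rewrite /Q divn_small // big_pred0.
have QS l : Q l = Q l.+1 +
    (if odd (n %/ 2 ^ l) then \sum_(u : 'I_(2 ^ L) | (u %/ 2 ^ l == (n %/ 2 ^ l).-1)%N) h u else 0).
  rewrite /Q (bigID (fun u : 'I_(2 ^ L) => (u %/ 2 ^ l.+1 < n %/ 2 ^ l.+1)%N)) /=.
  congr (_ + _).
    apply: eq_bigl => u; rewrite expnSr !divnMA; lia.
  case: ifP; [move=> o; apply: eq_bigl => u | move=> o; apply: big_pred0 => u];
    rewrite expnSr !divnMA; move: (n %/ 2 ^ l)%N o (u %/ 2 ^ l)%N => b o a; lia.
have tel m : Q 0%N = Q m + \sum_(l < m)
    if odd (n %/ 2 ^ l) then \sum_(u : 'I_(2 ^ L) | (u %/ 2 ^ l == (n %/ 2 ^ l).-1)%N) h u else 0.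
  elim: m => [|m IH]; first by rewrite big_ord0 addr0.
  by rewrite IH big_ord_recr /= [Q m]QS -!addrA; congr (_ + _); rewrite addrC.
by rewrite Q0 (tel L) QL add0r.
Qed.

(** All blocks of all levels are included, so that this majorant is the same for every prefix. *)
Definition dyadic_moment (C : numClosedFieldType) k L (h : 'I_(2 ^ L) -> C) : C :=
  \sum_(l < L) \sum_(q < 2 ^ L) `|\sum_(u : 'I_(2 ^ L) | (u %/ 2 ^ l == q)%N) h u| ^+ (2 * k).

(** The power mean inequality over the L levels, after which the block used at each level is
    majorised by the sum over all blocks of that level. *)
Lemma norm_prefix_dyadic (C : numClosedFieldType) k L (h : 'I_(2 ^ L) -> C) n :
  (0 < k)%N -> (n < 2 ^ L)%N ->
  `|\sum_(u : 'I_(2 ^ L) | (u < n)%N) h u| ^+ (2 * k) <= L%:R ^+ (2 * k).-1 * dyadic_moment k h.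
Proof.
move=> k0 nL; rewrite sum_prefix_dyadic //.
have k2 : (2 * k = (2 * k).-1.+1)%N by lia.
pose a (l : 'I_L) := `|if odd (n %/ 2 ^ l) then \sum_(u : 'I_(2 ^ L) | (u %/ 2 ^ l == (n %/ 2 ^ l).-1)%N) h u else 0|.
apply: (@le_trans _ _ ((\sum_l a l) ^+ (2 * k))).
  apply: lerXn2r; rewrite ?nnegrE //; last exact: ler_norm_sum.
  by apply: sumr_ge0 => l _; exact: normr_ge0.
rewrite {1}k2; apply: le_trans (@power_mean _ _ xpredT _ _ _) _ => [l _|]; first exact: normr_ge0.
rewrite -k2 cardT size_enum_ord ler_wpM2l ?exprn_ge0 //; apply: ler_sum => l _.
rewrite /a; case: ifP => o; last first.
  by rewrite normr0 expr0n muln_eq0 /= eqn0Ngt k0 sumr_ge0 // => q _; rewrite exprn_ge0.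
have ql : ((n %/ 2 ^ l).-1 < 2 ^ L)%N.
  by apply: leq_ltn_trans nL; apply: leq_trans (leq_pred _) (leq_div _ _).
rewrite [leRHS](bigD1 (Ordinal ql)) //= lerDl sumr_ge0 // => q _; exact: exprn_ge0.
Qed.

Lemma convex_nat_interval (Q : pred nat) H : (0 < H)%N -> (forall u, Q u -> (u.+1 < H)%N) ->
  (forall u1 u u2, Q u1 -> Q u2 -> (u1 <= u <= u2)%N -> Q u) ->
  exists lo hi, [/\ (lo <= hi)%N, (hi < H)%N & forall u, Q u = (lo <= u < hi)%N].
Proof.
move=> H0 QH Qc; have [ex|nex] := pselect (exists u, Q u); last first.
  exists 0%N, 0%N; split=> // u; rewrite ltn0 andbF; apply/negP => Qu.
  by apply: nex; exists u.
have ub u : Q u -> (u <= H)%N by move=> /QH; lia.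
case: (ex_minnP ex) => lo Qlo minlo; case: (ex_maxnP ex ub) => hi Qhi maxhi.
exists lo, hi.+1; split; [exact: leqW (minlo _ Qhi) | exact: QH |].
by move=> u; apply/idP/idP => [Qu|h]; [rewrite ltnS minlo // maxhi | exact: Qc Qlo Qhi h].
Qed.

(** An interval is a difference of two prefixes; the power mean of two terms costs 2 ^ (2 k - 1),
    and adding their equal bounds costs another 2. *)
Lemma norm_interval_dyadic (C : numClosedFieldType) k L (h : 'I_(2 ^ L) -> C) (Q : pred nat) :
  (0 < k)%N -> (forall u, Q u -> (u.+1 < 2 ^ L)%N) ->
  (forall u1 u u2, Q u1 -> Q u2 -> (u1 <= u <= u2)%N -> Q u) ->
  `|\sum_(u : 'I_(2 ^ L) | Q u) h u| ^+ (2 * k) <=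
    (2 ^ (2 * k) * L ^ (2 * k).-1)%:R * dyadic_moment k h.
Proof.
move=> k0 QH Qc; have k2 : (2 * k = (2 * k).-1.+1)%N by lia.
have [lo [hi [lh hH eQ]]] := @convex_nat_interval Q (2 ^ L) (expn_gt0 2 L) QH Qc.
have -> : \sum_(u : 'I_(2 ^ L) | Q u) h u =
    \sum_(u : 'I_(2 ^ L) | (u < hi)%N) h u - \sum_(u : 'I_(2 ^ L) | (u < lo)%N) h u.
  rewrite [X in _ = X - _](bigID (fun u : 'I_(2 ^ L) => (u < lo)%N)) /=.
  rewrite [X in _ = X + _ - _](eq_bigl (fun u : 'I_(2 ^ L) => (u < lo)%N)); last by move=> u; lia.
  by rewrite addrAC subrr add0r; apply: eq_bigl => u; rewrite eQ; lia.
pose a (b : bool) := `|\sum_(u : 'I_(2 ^ L) | (u < if b then hi else lo)%N) h u|.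
apply: (@le_trans _ _ ((\sum_b a b) ^+ (2 * k))).
  by rewrite big_bool /a /=; apply: lerXn2r; rewrite ?nnegrE ?addr_ge0 ?ler_normB.
rewrite {1}k2; apply: le_trans (@power_mean _ _ xpredT _ _ _) _ => [b _|]; first exact: normr_ge0.
rewrite -k2 cardT -cardE card_bool.
have -> : (2 ^ (2 * k) * L ^ (2 * k).-1)%:R * dyadic_moment k h =
   2%:R ^+ (2 * k).-1 * \sum_(b : bool) (L%:R ^+ (2 * k).-1 * dyadic_moment k h) :> C.
  by rewrite big_bool natrM {1}k2 expnSr natrM !natrX /=; ring.
rewrite ler_wpM2l ?exprn_ge0 //; apply: ler_sum => b _.
by apply: norm_prefix_dyadic => //; case: b; lia.
Qed.

(** The blocks of one level are the fibres of u -> u / 2 ^ l, and solutions inside single fibres are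
    among all solutions; so each level costs at most one full moment. *)
Lemma sum_dyadic_moment (F : finFieldType) (C : numClosedFieldType) (e : F -> C) k L
    (P : pred 'I_(2 ^ L)) (phi : 'I_(2 ^ L) -> F) (c : 'I_(2 ^ L) -> C) :
  primitive_char e -> (0 < k)%N -> (forall i, P i -> `|c i| <= 1) ->
  \sum_v dyadic_moment k (fun u => if P u then c u * e (v * phi u) else 0) <=
  (L * (#|F| * zero_sums k P phi))%:R.
Proof.
move=> eP k0 c1; rewrite exchange_big /=.
have -> : (L * (#|F| * zero_sums k P phi))%N = (\sum_(l < L) #|F| * zero_sums k P phi)%N.
  by rewrite sum_nat_const card_ord.
rewrite natr_sum.
apply: ler_sum => l _; rewrite exchange_big /=.
pose g (u : 'I_(2 ^ L)) : 'I_(2 ^ L) := Ordinal (leq_ltn_trans (leq_div u (2 ^ l)) (ltn_ord u)).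
apply: (@le_trans _ _ ((\sum_q #|F| * zero_sums k [pred i | P i && (g i == q)] phi)%N%:R)); last first.
  by rewrite ler_nat -big_distrr leq_mul2l zero_sums_sum_fibres ?orbT.
rewrite natr_sum; apply: ler_sum => q _.
apply: le_trans (moment_le k (P := [pred i | P i && (g i == q)]) phi (c := c) eP _); last first.
  by move=> i /andP[/c1].
apply: ler_sum => v _; rewrite -big_mkcondr /=.
by rewrite (eq_bigl [pred i | P i && (g i == q)]) // => u; rewrite inE /= andbC.
Qed.

(** * The additive characters of F_p *)

Lemma e_pD (R : realType) p (x y : R) : e_p p (x + y) = e_p p x * e_p p y.
Proof.
rewrite /e_p mulrDr mulrDl cosD sinD; simpc; congr (_ +i* _)%C.
by rewrite addrC; congr (_ + _); rewrite mulrC.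
Qed.

Lemma e_p_period (R : realType) p n : (0 < p)%N -> e_p p (n * p)%:R = 1 :> R[i].
Proof.
move=> p0; have p0R : p%:R != 0 :> R by rewrite pnatr_eq0 -lt0n.
elim: n => [|n IH].
  by rewrite mul0n /e_p mulr0 mul0r cos0 sin0.
rewrite mulSn natrD e_pD IH mulr1 /e_p mulfK //.
have -> : 2 * pi = pi + pi :> R by ring.
by rewrite cosD sinD cospi sinpi; congr (_ +i* _)%C; ring.
Qed.

Lemma e_p_mod (R : realType) p n : (0 < p)%N -> e_p p (n %% p)%:R = e_p p n%:R :> R[i].
Proof. by move=> p0; rewrite {2}(divn_eq n p) natrD e_pD e_p_period // mul1r. Qed.

Lemma norm_e_p (R : realType) p (x : R) : `|e_p p x| = 1.
Proof. by rewrite normc_def /e_p /= cos2Dsin2 sqrtr1. Qed.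

(** The real part is cos (2 x) = 1 - 2 sin (x) ^ 2 with 0 < x < pi, hence less than 1. *)
Lemma e_p_neq1 (R : realType) p n : (0 < n < p)%N -> e_p p n%:R != 1 :> R[i].
Proof.
move=> /andP[n0 np]; apply/eqP => /(congr1 (@complex.Re R)) /=.
have p0 : (0 < p)%N := ltn_trans n0 np.
have p0R : 0 < p%:R :> R by rewrite ltr0n.
pose x : R := pi * (n%:R / p%:R).
have -> : 2 * pi * n%:R / p%:R = x + x by rewrite /x; ring.
have s0 : 0 < sin x.
  apply: sin_gt0_pi; rewrite /x mulr_gt0 ?pi_gt0 ?divr_gt0 ?ltr0n //=.
  by rewrite gtr_pMr ?pi_gt0 // ltr_pdivrMr // mul1r ltr_nat.
rewrite cosD; have := cos2Dsin2 x; have := mulr_gt0 s0 s0; rewrite !expr2; lra.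
Qed.

Definition Fp_char (R : realType) p (x : 'F_p) : R[i] := e_p p (val x)%:R.

Lemma Fp_char_primitive (R : realType) p : prime p -> primitive_char (@Fp_char R p).
Proof.
move=> pP; have p0 := prime_gt0 pP.
have eD : {morph @Fp_char R p : x y / x + y >-> x * y}.
  move=> x y; rewrite /Fp_char -e_pD -natrD -[RHS]e_p_mod //; congr (e_p p _%:R).
  by rewrite /= [X in (_ %% X)%N]Fp_cast.
split=> // [x|w w0]; first exact: norm_e_p.
have w1 : Fp_char R w != 1.
  apply: e_p_neq1; rewrite ltn_Fp // andbT lt0n; apply: contra w0 => /eqP h.
  exact/eqP/val_inj.
(* The translation v -> 1 + v multiplies the sum by the value at w, which is not 1; so the sum
   vanishes. *)
apply/eqP; move: w1; rewrite -subr_eq0 => w1; rewrite -(mulrI_eq0 _ (mulfI w1)) mulrBl mul1r subr_eq0.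
rewrite mulr_sumr [eqbRHS](reindex_inj (addrI 1)) /=; apply/eqP; apply: eq_bigr => v _.
by rewrite mulrDl mul1r eD.
Qed.

(** * From the bilinear sum over a convex set to the count of solutions *)

Lemma convex_set_row (R : realType) (C : set (R^o * R^o)) (v : R) (u1 u u2 : nat) :
  convex_set C -> ((u1%:R, v) : R^o * R^o) \in C -> ((u2%:R, v) : R^o * R^o) \in C ->
  (u1 <= u <= u2)%N -> ((u%:R, v) : R^o * R^o) \in C.
Proof.
move=> cC h1 h2 /andP[l1 l2].
(* The weight (u2 - u) / (u2 - u1) of the convex combination needs u1 and u2 to be distinct. *)
have [e12|ne] := eqVneq u1 u2.
  by have -> : u = u1 by lia.
have d0 : 0 < (u2 - u1)%:R :> R by rewrite ltr0n subn_gt0 ltn_neqAle ne (leq_trans l1).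
have t0 : 0 <= (u2 - u)%:R / (u2 - u1)%:R :> R by rewrite divr_ge0.
have t1 : (u2 - u)%:R / (u2 - u1)%:R <= 1 :> R.
  by rewrite ler_pdivrMr // mul1r ler_nat; lia.
have := cC _ _ (Itv01 t0 t1) h1 h2.
suff -> : conv (Itv01 t0 t1) ((u1%:R, v) : convex_lmodType (R^o * R^o)%type) (u2%:R, v) = (u%:R, v) by [].
have E1 : (u2 - u)%:R / (u2 - u1)%:R * u1%:R + (1 - (u2 - u)%:R / (u2 - u1)%:R) * u2%:R = u%:R :> R.
  have d1 : (u2 - u1)%:R != 0 :> R by rewrite gt_eqF.
  rewrite !natrB ?(leq_trans l1) // in d1 *; field.
  exact: d1.
rewrite /conv /=; congr pair; first exact: E1.
by rewrite -[RHS]mul1r -[in RHS](subrK (((u2 - u)%:R / (u2 - u1)%:R) : R) 1) mulrDl addrC.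
Qed.

Lemma sum_nat_ord (W : zmodType) (g : nat -> W) b n : (b < n)%N ->
  \sum_(1 <= i < b.+1) g i = \sum_(i < n | (0 < i <= b)%N) g i.
Proof.
move=> bn; rewrite (big_nat_widen _ _ _ _ _ bn) (@big_nat_widenl _ _ _ 1 0) // big_mkord.
by apply: eq_bigl => i; rewrite andTb andbC.
Qed.

(** Since V < p, v can be read as an element of F_p. Hölder over the at most V values of v removes
    beta, convexity makes each row an interval, and the dyadic majorant no longer depends on that
    interval. *)
Lemma S_sum_moment (R : realType) (p d k U V L : nat) (a b : 'F_p) (alpha beta : nat -> R[i])
    (C : set (R^o * R^o)) :
  prime p -> (p < 2 ^ L)%N -> (0 < k)%N -> (U < p)%N -> (V < p)%N -> convex_set C ->
  (forall u, (1 <= u <= U)%N -> `|alpha u| <= 1) ->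
  (forall v, (1 <= v <= V)%N -> `|beta v| <= 1) ->
  `|S_sum d U V a b alpha beta C| ^+ (2 * k) <=
  (V ^ (2 * k).-1 * (2 ^ (2 * k) * L ^ (2 * k).-1 * (L * (p * zero_sums k
     [pred u : 'I_(2 ^ L) | (0 < u <= U)%N && (a * u%:R + b != 0)%R]
     (fun u : 'I_(2 ^ L) => ((a * u%:R + b) ^- d)%R)))))%:R.
Proof.
move=> pP pL k0 Up Vp cC al be.
have k2 : (2 * k = (2 * k).-1.+1)%N by lia.
pose P := [pred u : 'I_(2 ^ L) | (0 < u <= U)%N && (a * u%:R + b != 0)%R].
pose phi := fun u : 'I_(2 ^ L) => ((a * u%:R + b) ^- d)%R.
pose h (v : 'F_p) (u : 'I_(2 ^ L)) := if P u then alpha u * Fp_char R (v * phi u) else 0.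
pose Q (v : 'F_p) (u : nat) := (0 < u <= U)%N && (((u%:R, (val v)%:R) : R^o * R^o) \in C).
have ES : S_sum d U V a b alpha beta C =
    \sum_(v : 'F_p | (0 < val v <= V)%N) beta (val v) * \sum_(u : 'I_(2 ^ L) | Q v u) h v u.
  rewrite /S_sum; under eq_bigr do rewrite big_mkcond.
  rewrite exchange_big_nat /= (@sum_nat_ord _ _ V (Zp_trunc (pdiv p)).+2); last by rewrite Fp_cast.
  apply: eq_bigr => v _; rewrite (@sum_nat_ord _ _ U (2 ^ L)); last exact: ltn_trans pL.
  rewrite mulr_sumr big_mkcond [RHS]big_mkcond; apply: eq_bigr => u _ /=.
  rewrite /Q /h /=; case: (0 < u <= U)%N => //=; case: (_ \in C) => //=.
  case: ifP => _; last by rewrite mulr0.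
  by rewrite natr_Zp [alpha u * _]mulrC -mulrA.
have bnd v : `|\sum_(u : 'I_(2 ^ L) | Q v u) h v u| ^+ (2 * k) <=
    (2 ^ (2 * k) * L ^ (2 * k).-1)%:R * dyadic_moment k (h v).
  apply: norm_interval_dyadic => // [u /andP[/andP[_ uU] _]|u1 u u2].
    by apply: leq_ltn_trans pL; apply: leq_ltn_trans Up.
  move=> /andP[/andP[u10 _] C1] /andP[/andP[_ u2U] C2] /andP[l1 l2].
  rewrite /Q (leq_trans u10 l1) (leq_trans l2 u2U) /=.
  by apply: convex_set_row cC C1 C2 _; rewrite l1.
pose T v := `|\sum_(u : 'I_(2 ^ L) | Q v u) h v u|.
pose PV := [pred v : 'F_p | (0 < val v <= V)%N].
have cV : (#|PV| <= V)%N.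
  rewrite -[leqRHS](card_ord V); apply: leq_trans (leq_image_card (fun i : 'I_V => i.+1%:R : 'F_p) _).
  apply: subset_leq_card; apply/fintype.subsetP => v /andP[v0 vV].
  have vlt : ((val v).-1 < V)%N by rewrite prednK.
  apply/fintype.imageP; exists (Ordinal vlt) => //.
  have -> : (Ordinal vlt).+1 = val v by exact: prednK.
  by rewrite natr_Zp.
apply: (@le_trans _ _ ((\sum_(v | PV v) T v) ^+ (2 * k))).
  apply: lerXn2r; rewrite ?nnegrE ?normr_ge0 //.
    by apply: sumr_ge0 => v _; exact: normr_ge0.
  rewrite ES; apply: le_trans (ler_norm_sum _ _ _) _; apply: ler_sum => v hv.
  by rewrite normrM ler_piMl ?normr_ge0 // be.
rewrite {1}k2; apply: le_trans (@power_mean _ _ PV _ _ _) _ => [v _|]; first exact: normr_ge0.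
rewrite -k2 natrM; apply: ler_pM; rewrite ?exprn_ge0 ?ler0n //.
- by apply: sumr_ge0 => v _; rewrite exprn_ge0 // normr_ge0.
- by rewrite -natrX ler_nat leq_exp2r //; lia.
(* The terms being nonnegative, v may now range over all of F_p, as orthogonality requires. *)
rewrite natrM; apply: (@le_trans _ _ ((2 ^ (2 * k) * L ^ (2 * k).-1)%:R * \sum_v dyadic_moment k (h v))).
  rewrite mulr_sumr [leRHS](bigID PV) /=; apply: (@le_trans _ _ (\sum_(v | PV v)
     (2 ^ (2 * k) * L ^ (2 * k).-1)%:R * dyadic_moment k (h v))).
    by apply: ler_sum => v _; exact: bnd.
  rewrite lerDl; apply: sumr_ge0 => v _; apply: le_trans (bnd v).
  by rewrite exprn_ge0.
rewrite ler_wpM2l ?ler0n //.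
have := @sum_dyadic_moment _ _ _ k L P phi (fun u => alpha u)
  (Fp_char_primitive R pP) k0.
by rewrite card_Fp //; apply => u /andP[/al].
Qed.

(** * Optimisation *)

(** For the largest admissible X, the value X + 1 <= 2 X violates one of the two upper bounds, so
    one of them is attained up to the factor 2. *)
Lemma exists_shift_length k U p : (0 < k)%N -> (0 < U < p)%N ->
  exists X, [/\ (0 < X)%N, (X * U <= p)%N, (X ^ k.+1 <= U ^ k.-1)%N
    & (p <= 2 * X * U)%N || (U ^ k.-1 <= (2 * X) ^ k.+1)%N].
Proof.
move=> k0 /andP[U0 Up].
pose A X := [&& (0 < X)%N, (X * U <= p)%N & (X ^ k.+1 <= U ^ k.-1)%N].
have A1 : exists X, A X.
  by exists 1%N; rewrite /A mul1n exp1n expn_gt0 U0 (ltnW Up).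
have ub X : A X -> (X <= p)%N.
  by move=> /and3P[_ h _]; apply: leq_trans h; rewrite leq_pmulr.
case: (ex_maxnP A1 ub) => X /and3P[X0 XU Xk] mx; exists X; split=> //.
apply: contraT; rewrite negb_or -!ltnNge => /andP[h1 h2].
have X2 : (X.+1 <= 2 * X)%N by lia.
have : A X.+1.
  rewrite /A /= (leq_trans (leq_mul X2 (leqnn U)) (ltnW h1)) /=.
  by rewrite (leq_trans _ (ltnW h2)) // leq_exp2r.
by move=> /mx; rewrite ltnn.
Qed.

(** The leading 2 pays for the doubled X. In [loss], L ^ (2 k) comes from the dyadic decomposition,
    L ^ (2 k) from the density of primes and L ^ 4 from the cutoff. *)
Definition loss_const k d := (2 * 2 ^ (2 * k) * 6 ^ (2 * k) * 3 ^ (2 * k).-1 * moment_const k d)%N.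
Definition loss k d L := (loss_const k d * L ^ (4 * k + 4))%N.

Lemma loss_const_gt0 k d : (0 < k)%N -> (0 < loss_const k d)%N.
Proof. by move=> k0; rewrite /loss_const /moment_const !(muln_gt0, addn_gt0, expn_gt0) k0. Qed.

Lemma addX_le_Xadd (R : realDomainType) (a b : R) n : 0 <= a -> 0 <= b ->
  a ^+ n.+1 + b ^+ n.+1 <= (a + b) ^+ n.+1.
Proof.
move=> a0 b0; elim: n => [|n IH]; first by rewrite !expr1.
rewrite [leRHS]exprS; apply: le_trans (ler_wpM2l (addr_ge0 a0 b0) IH).
have h1 : 0 <= a * b ^+ n.+1 by rewrite mulr_ge0 // exprn_ge0.
have h2 : 0 <= b * a ^+ n.+1 by rewrite mulr_ge0 // exprn_ge0.
by rewrite ![_ ^+ n.+2]exprS; lra.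
Qed.

(** Because 2 k ^ 2 + k - 1 = (2 k - 1) (k + 1). The second factor is the one that X cancels when X
    is about U ^ ((k - 1) / (k + 1)). *)
Lemma powR_balance (R : realType) k (u : R) : (0 < k)%N -> 0 < u ->
  u ^+ (2 * k).-1 = u `^ (2 * k%:R * (k%:R / (k%:R + 1))) * u `^ ((k%:R - 1) / (k%:R + 1)).
Proof.
move=> k0 u0; rewrite -powRD; last by rewrite (gt_eqF u0) implybT.
rewrite -powR_mulrn ?ltW //; congr (_ `^ _).
have k1 : k%:R + 1 != 0 :> R by rewrite natr1 pnatr_eq0.
rewrite -subn1 natrB ?muln_gt0 // natrM; field.
exact: k1.
Qed.

(** Up to the loss, X times the moment is at most V ^ (2 k - 1) U ^ (2 k - 1) p. If p <= 2 X U, this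
    gives the term U ^ (2 k); otherwise X is large enough to cancel the second factor of
    [powR_balance]. *)
Lemma moment_dichotomy (R : realType) k d p U V X L J (N : R) :
  (0 < k)%N -> (0 < U)%N -> (0 < X)%N ->
  N ^+ (2 * k) <= (V ^ (2 * k).-1 * (2 ^ (2 * k) * L ^ (2 * k).-1 * (L * (p * J))))%:R ->
  (X * J <= (6 * L) ^ (2 * k) * (3 * U) ^ (2 * k).-1 * (moment_const k d * L ^ 4))%N ->
  (p <= 2 * X * U)%N || (U ^ k.-1 <= (2 * X) ^ k.+1)%N ->
  N ^+ (2 * k) <= (loss k d L * V ^ (2 * k).-1)%:R *
    (U%:R ^+ (2 * k) + U%:R `^ (2 * k%:R * (k%:R / (k%:R + 1))) * p%:R).
Proof.
move=> k0 U0 X0 hN hJ hX; set e := (2 * k).-1 in hN hJ *.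
have k2 : (2 * k = e.+1)%N by rewrite /e; lia.
have X0R : 0 < X%:R :> R by rewrite ltr0n.
have U0R : 0 < U%:R :> R by rewrite ltr0n.
pose A := (2 ^ (2 * k) * 6 ^ (2 * k) * 3 ^ e * moment_const k d * L ^ (4 * k + 4))%N.
have EA : loss k d L = (2 * A)%N by rewrite /loss /loss_const /A -/e !mulnA.
have key : X%:R * N ^+ (2 * k) <= (A * V ^ e)%:R * (U%:R ^+ e * p%:R).
  apply: le_trans (ler_wpM2l (ltW X0R) hN) _; rewrite -natrX -!natrM ler_nat.
  have -> : (X * (V ^ e * (2 ^ (2 * k) * L ^ e * (L * (p * J)))) =
             V ^ e * 2 ^ (2 * k) * (L ^ e * L) * p * (X * J))%N by lia.
  apply: leq_trans (leq_mul (leqnn _) hJ) _; rewrite -expnSr -k2 /A.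
  have -> : (4 * k + 4 = 2 * k + 2 * k + 4)%N by lia.
  rewrite !expnMn !expnD; apply: eq_leq; ring.
have P0 : 0 <= U%:R `^ (2 * k%:R * (k%:R / (k%:R + 1))) * p%:R :> R by rewrite mulr_ge0 ?powR_ge0.
have U20 : 0 <= U%:R ^+ (2 * k) :> R by rewrite exprn_ge0.
have AV0 : 0 <= (A * V ^ e)%:R :> R by [].
rewrite EA -mulnA natrM -(ler_pM2l X0R); apply: le_trans key _.
have -> : X%:R * (2%:R * (A * V ^ e)%:R * (U%:R ^+ (2 * k) + U%:R `^ (2 * k%:R * (k%:R / (k%:R + 1))) * p%:R))
  = (A * V ^ e)%:R * ((2 * X)%:R * (U%:R ^+ (2 * k) + U%:R `^ (2 * k%:R * (k%:R / (k%:R + 1))) * p%:R)) :> R.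
  by rewrite natrM; ring.
rewrite ler_wpM2l //; case/orP: hX => hX.
  apply: (@le_trans _ _ ((2 * X)%:R * U%:R ^+ (2 * k))); last by rewrite ler_wpM2l // lerDl.
  rewrite k2 exprSr mulrCA ler_wpM2l ?exprn_ge0 //.
  by rewrite -natrM ler_nat.
apply: (@le_trans _ _ ((2 * X)%:R * (U%:R `^ (2 * k%:R * (k%:R / (k%:R + 1))) * p%:R)));
  last by rewrite ler_wpM2l // lerDr.
rewrite /e powR_balance // -[leLHS]mulrA [leRHS]mulrCA ler_wpM2l ?powR_ge0 //.
rewrite ler_wpM2r //.
have k1 : 0 < k%:R + 1 :> R by rewrite natr1 ltr0n.
have -> : (2 * X)%:R = (((2 * X)%:R : R) ^+ k.+1) `^ ((k%:R + 1)^-1) :> R.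
  by rewrite -powR_mulrn // -powRrM -natr1 mulfV ?gt_eqF // powRr1.
have -> : k%:R - 1 = k.-1%:R :> R by rewrite -{1}(prednK k0) -natr1 addrK.
rewrite powRrM powR_mulrn //; apply: ge0_ler_powR; rewrite ?nnegrE ?exprn_ge0 ?invr_ge0 ?(ltW k1) //.
by rewrite -!natrX ler_nat.
Qed.

(** * The loss as a power p ^ o(1) *)

Definition loss_exponent (R : realType) k d p : R :=
  ln (loss k d (trunc_log 2 p).+1)%:R / ((2 * k)%:R * ln p%:R).

Lemma powR_loss_exponent (R : realType) k d p : (0 < k)%N -> (1 < p)%N ->
  (p%:R `^ loss_exponent R k d p) ^+ (2 * k) = (loss k d (trunc_log 2 p).+1)%:R.
Proof.
move=> k0 p1; have p0 : 0 < p%:R :> R by rewrite ltr0n ltnW.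
have lp : 0 < ln (p%:R : R) by rewrite ln_gt0 // ltr1n.
have k2 : (2 * k)%:R != 0 :> R by rewrite pnatr_eq0 -lt0n muln_gt0.
rewrite -powR_mulrn ?powR_ge0 // -powRrM /powR gt_eqF // /loss_exponent.
set l := ln (loss _ _ _)%:R.
rewrite -mulrA divfK; last by rewrite mulf_neq0 // gt_eqF.
by rewrite /l lnK // posrE ltr0n /loss muln_gt0 loss_const_gt0 // expn_gt0.
Qed.

Lemma ln_le_sqrt (R : realType) (x : R) : 0 < x -> ln x <= 2 * Num.sqrt x.
Proof.
move=> x0; have s0 : 0 < Num.sqrt x by rewrite sqrtr_gt0.
rewrite -{1}(sqr_sqrtr (ltW x0)) lnXn // mulr_natl lerMn2r /=.
have := @le_ln1Dx R (Num.sqrt x - 1); rewrite addrCA subrr addr0 => h.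
by apply: le_trans (h _) _; lra.
Qed.

(* [ln (loss p) = O (ln ln p)], while the denominator is [ln p]. *)
Lemma loss_exponent_cvg0 (R : realType) k d : (0 < k)%N ->
  (loss_exponent R k d p @[p --> \oo] --> (0 : R))%classic.
Proof.
move=> k0; apply/cvgrPdist_le => /= ep ep0.
have K0 : (0 < loss_const k d)%N by exact: loss_const_gt0.
pose c := (4 * k + 4)%N; pose K : R := ln (loss_const k d)%:R + 2 * c%:R.
have lK : 0 <= ln ((loss_const k d)%:R : R) by rewrite ln_ge0 // ler1n.
have l2 : 0 < ln (2 : R) by rewrite ln_gt0 // ltr1n.
have k1 : 1 <= (k%:R : R) by rewrite ler1n.
have K0R : 0 <= K by rewrite addr_ge0 // mulr_ge0.
(* With x = l + 1, the numerator is at most K sqrt x and the denominator at least x ln 2, so the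
   quotient is at most [ep] once sqrt x >= B. *)
pose B := K / (ep * ln 2); have B0 : 0 <= B by rewrite divr_ge0 // mulr_ge0 // ltW.
pose M := (Num.bound (B ^+ 2)).+1.
near=> p.
have pM : (2 ^ M <= p)%N by near: p; exact: nbhs_infty_ge.
rewrite sub0r normrN; set l := trunc_log 2 p.
have Ml : (M <= l)%N by exact: trunc_log_max.
have l0 : (0 < l)%N := leq_trans (ltn0Sn _) Ml.
have p0 : (0 < p)%N by apply: leq_trans pM; rewrite expn_gt0.
have lp : l%:R * ln 2 <= ln (p%:R : R).
  rewrite mulr_natl -lnXn // ler_ln ?posrE ?exprn_gt0 ?ltr0n // -natrX ler_nat.
  exact: trunc_logP.
pose x : R := l.+1%:R; pose r := Num.sqrt x.
have x0 : 0 < x by rewrite ltr0n.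
have x1 : 1 <= x by rewrite ler1n.
have r1 : 1 <= r by rewrite -sqrtr1 ler_wsqrtr.
have rr : r ^+ 2 = x by rewrite sqr_sqrtr // ltW.
have xl : x <= 2 * l%:R by rewrite /x -natrM ler_nat mul2n -addnn -addn1 leq_add2l.
have Br : B <= r.
  rewrite -(@ler_pXn2r _ 2) ?nnegrE ?sqrtr_ge0 // rr.
  apply: le_trans (ltW (archi_boundP (sqr_ge0 B))) _; rewrite ler_nat.
  exact: leq_trans (leqnSn _) (leqW Ml).
have lossE : ln ((loss k d l.+1)%:R : R) = ln (loss_const k d)%:R + c%:R * ln x.
  rewrite /loss natrM natrX lnM ?posrE ?exprn_gt0 ?ltr0n // lnXn ?ltr0n //.
  by rewrite mulr_natl.
have ln_x := ln_le_sqrt x0; have lx0 : 0 <= ln x by rewrite ln_ge0.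
have num : ln ((loss k d l.+1)%:R : R) <= K * r.
  rewrite lossE /K mulrDl; apply: lerD; first by rewrite ler_peMr.
  by rewrite -mulrA mulrCA ler_wpM2l.
have num0 : 0 <= ln ((loss k d l.+1)%:R : R) by rewrite lossE addr_ge0 // mulr_ge0.
have lnp0 : 0 < ln (p%:R : R) by apply: lt_le_trans lp; rewrite mulr_gt0 // ltr0n.
have den0 : 0 < (2 * k)%:R * ln (p%:R : R) by rewrite mulr_gt0 // ltr0n muln_gt0.
rewrite /loss_exponent -/l ger0_norm; last by rewrite divr_ge0 // ltW.
rewrite ler_pdivrMr //; apply: le_trans num _.
have KB : K = B * (ep * ln 2) by rewrite /B divfK // gt_eqF // mulr_gt0.
apply: (@le_trans _ _ (ep * (x * ln 2))).
  rewrite KB -rr; have -> : ep * (r ^+ 2 * ln 2) = r * (ep * ln 2) * r by ring.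
  rewrite ler_wpM2r ?sqrtr_ge0 // ler_wpM2r // mulr_ge0 // ltW //.
rewrite ler_wpM2l ?(ltW ep0) //; apply: (@le_trans _ _ (2 * (l%:R * ln 2))).
  by rewrite mulrA ler_wpM2r // ltW.
rewrite natrM -mulrA ler_wpM2l //; apply: le_trans lp _.
by rewrite ler_peMl // ltW.
Unshelve. all: by end_near.
Qed.

(** * Deduction of the bound for the bilinear sum *)

Local Open Scope complex_scope.
Local Open Scope classical_set_scope.

Theorem theorem2p3 (R : realType) (d k : nat) (hd : (1 <= d)%N) (hk : (1 <= k)%N) :
  exists eps : nat -> R,
    eps @ \oo --> (0 : R) /\
    forall (p U V : nat) (C : set (R^o * R^o)) (alpha beta : nat -> R[i])
           (a b : 'F_p),
      prime p ->
      (1 <= U < p)%N -> (1 <= V < p)%N ->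
      convex_set C ->
      C `<=` `[1, U%:R] `*` `[1, V%:R] ->
      (forall u, (1 <= u <= U)%N -> `|alpha u| <= 1) ->
      (forall v, (1 <= v <= V)%N -> `|beta v| <= 1) ->
      a != 0 ->
      `|S_sum d U V a b alpha beta C| <=
        (V%:R `^ (1 - (2 * k%:R)^-1) *
         (U%:R + U%:R `^ (k%:R / (k%:R + 1)) * p%:R `^ ((2 * k%:R)^-1)) *
         p%:R `^ (eps p))%:C.
Proof.
exists (loss_exponent R k d); split; first exact: loss_exponent_cvg0.
move=> p U V C alpha beta a b pP /andP[U0 Up] /andP[V0 Vp] cC _ hal hbe a0.
set L := (trunc_log 2 p).+1; have p1 := prime_gt1 pP.
have pL : (p < 2 ^ L)%N by exact: trunc_log_ltn.
have hS := S_sum_moment d a b pP pL hk Up Vp cC hal hbe.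
have [|X [X0 XU Xk hX]] := @exists_shift_length k U p hk; first by rewrite U0.
have := @zero_sums_reciprocal _ _ _ k d U X L (2 ^ L) (b / a) pP (Fp_char_primitive R pP) hk hd _ pL X0 XU Xk.
rewrite U0 => /(_ Up) hJ.
set J := zero_sums _ _ _ in hS; set J' := zero_sums _ _ _ in hJ.
(* Writing a u + b = a (u + b / a), the common factor a ^ - d does not affect the solutions; the
   shift is s = b / a. *)
have EJ : J = J'.
  have ab (u : 'I_(2 ^ L)) : a * u%:R + b = a * (u%:R + b / a) by rewrite mulrDr mulrCA divff // mulr1.
  rewrite /J' -(@zero_sums_scale _ k _ _ _ (a ^- d)) ?invr_eq0 ?expf_neq0 //.
  apply: eq_card => f; rewrite !inE; congr (_ && _).
    by apply/ffun_onP/ffun_onP => h j; have := h j; rewrite !inE ab mulf_eq0 (negPf a0).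
  by congr (_ == _); apply: eq_bigr => j _; rewrite ab exprMn invfM.
rewrite -{J'}EJ in hJ.
move: hS; rewrite normc_def; set N := Num.sqrt _ => hS.
have {}hS : N ^+ (2 * k) <= (V ^ (2 * k).-1 * (2 ^ (2 * k) * L ^ (2 * k).-1 * (L * (p * J))))%:R.
  by rewrite -lecR rmorphXn rmorph_nat.
have N0 : 0 <= N by exact: sqrtr_ge0.
have hN := moment_dichotomy hk U0 X0 hS hJ hX.
rewrite lecR.
have k2 : (0 < 2 * k)%N by rewrite muln_gt0.
have k2R : 2 * k%:R != 0 :> R by rewrite -natrM pnatr_eq0 -lt0n.
have W0 : 0 <= U%:R + U%:R `^ (k%:R / (k%:R + 1)) * p%:R `^ (2 * k%:R)^-1 :> R.
  by rewrite addr_ge0 // mulr_ge0 // powR_ge0.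
(* Both sides are compared through their 2k-th powers; the two terms of the moment bound are then
   recombined by a ^ (2 k) + b ^ (2 k) <= (a + b) ^ (2 k). *)
rewrite -(ler_pXn2r k2) ?nnegrE ?mulr_ge0 ?powR_ge0 //.
apply: le_trans hN _.
rewrite [leRHS]exprMn [X in _ <= X * _]exprMn (powR_loss_exponent R d hk p1) -/L.
rewrite [X in X * _ <= _]natrM.
have -> : (V%:R `^ (1 - (2 * k%:R)^-1)) ^+ (2 * k) = (V ^ (2 * k).-1)%:R :> R.
  rewrite -powR_mulrn ?powR_ge0 // -powRrM natrX -powR_mulrn //; congr (_ `^ _).
  by rewrite -subn1 natrB // natrM mulrBl mulVf // mul1r.
rewrite [leRHS]mulrC [leRHS]mulrA; apply: ler_wpM2l; first by rewrite mulr_ge0 ?ler0n.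
have b0 : 0 <= U%:R `^ (k%:R / (k%:R + 1)) * p%:R `^ (2 * k%:R)^-1 :> R.
  by rewrite mulr_ge0 // powR_ge0.
rewrite -(prednK k2); apply: le_trans (addX_le_Xadd _ (ler0n _ _) b0).
rewrite prednK // lerD2l exprMn -!powR_mulrn ?powR_ge0 // -!powRrM.
by rewrite natrM mulVf // powRr1 // [k%:R / _ * _]mulrC.
Qed.
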